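(* Let $m\ge5$ be an integer and let $p_c(m)$ be the critical probability for (bond) percolation on the graph $G(m)$. Then $p_c(m)\le p$, where $p$ is the smallest solution $p\in[0,1]$, $p\ne0$, of the equation $$1-\frac4m=(1-2p)\left(\frac{4}{mp}\Big(1-(1-p)^mS_{m-2}\big(p(1-p)^{m-2}\big)\Big)-1\right),$$ where $S_{m-2}(x)=\sum_{k=0}^{m-2}\frac{a_k}{k+1}x^k$ and $a_k$ is the number of subtrees with $k$ edges of the infinite $m$-regular tree that contain a fixed vertex.
   Context: $G(m)$ is the infinite planar graph that is regular of degree $m$ and tiles the plane by elementary faces of length $m$ (the regular $\{m,m\}$ tiling, hyperbolic for $m\ge5$). It is edge-transitive. Percolation: each edge of $G(m)$ is declared open independently with probability $p$ (product measure $\mathbb P_p$). For an edge $e$, $\mathcal E(e)$ denotes the connected component of the open subgraph that contains $e$ (empty if $e$ is not open). The critical probability is $p_c=\inf\{p\in[0,1] : \mathbb P_p(|\mathcal E(e)|=\infty)>0\}$, which does not depend on $e$. *)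

(* Defs.v *)
From HB Require Import structures.
From mathcomp Require Import all_boot all_order all_algebra.
From mathcomp Require Import finmap.
From mathcomp Require Import all_classical all_reals all_analysis.

Set Implicit Arguments.
Unset Strict Implicit.
Unset Printing Implicit Defensive.

Import Order.TTheory GRing.Theory Num.Theory.
Local Open Scope classical_set_scope.
Local Open Scope ring_scope.

(** * The tiling graph G(m)

    A graph drawn on an oriented surface is given by its rotation system.  The
    edge [e] carries the two darts (half-edges) [(e, true)] and [(e, false)],
    one leaving each of its ends, and [rot] sends a dart to the next one, in
    cyclic order, leaving the same vertex.  Thus vertices are the orbits of
    [rot], faces are the orbits of [fnext] (the successor of a dart along the
    contour of the face lying on a fixed side of it), and the surface is
    obtained by gluing a disc along each face contour.  Taking the edges in a
    countType loses nothing: a connected locally finite graph is countable. *)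

Record rotation_system := RotationSystem {
  edge : countType;
  rot : edge * bool -> edge * bool
}.

Definition dart (G : rotation_system) : choiceType := (edge G * bool)%type.

Definition rev (G : rotation_system) (d : dart G) : dart G := (d.1, ~~ d.2).

Definition fnext (G : rotation_system) (d : dart G) : dart G := rot (rev d).

Definition same_vertex (G : rotation_system) (d d' : dart G) : Prop :=
  exists k : nat, iter k (@rot G) d = d'.

(* [d'] leaves from the vertex at which [d] arrives; [cycle (@follows G) s]
   thus says that [s] is a closed walk. *)
Definition follows (G : rotation_system) (d d' : dart G) : bool :=
  `[< same_vertex (rev d) d' >].

Definition adjacent (G : rotation_system) (e f : edge G) : Prop :=
  exists b c : bool, @same_vertex G (e, b) (f, c).

(* Edge set of the component containing [e] of the subgraph of edges open in
   [w]; it is empty when [e] is not open. *)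
Inductive open_cluster (G : rotation_system) (w : edge G -> bool) (e : edge G) :
    set (edge G) :=
| open_cluster_refl : w e -> open_cluster w e e
| open_cluster_step (f g : edge G) :
    open_cluster w e f -> adjacent f g -> w g -> open_cluster w e g.

Definition orbit_length (T : Type) (f : T -> T) (x : T) (m : nat) : Prop :=
  iter m f x = x /\ forall k : nat, (0 < k < m)%N -> iter k f x <> x.

(* The two kinds of elementary null-homotopic closed walks: going back and
   forth along an edge, and going once around a face (of length [m]). *)
Definition elementary_loop (m : nat) (G : rotation_system) (r : seq (dart G)) :
    Prop :=
  exists d : dart G, r = [:: d; rev d] \/ r = traject (@fnext G) d m.

(* Closed walks that reduce to the trivial one by inserting and deleting
   elementary loops. *)
Inductive contractible (m : nat) (G : rotation_system) : seq (dart G) -> Prop :=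
| contractible_nil : contractible m [::]
| contractible_insert (s1 r s2 : seq (dart G)) :
    elementary_loop m r -> cycle (@follows G) (s1 ++ r ++ s2) ->
    contractible m (s1 ++ s2) -> contractible m (s1 ++ r ++ s2)
| contractible_delete (s1 r s2 : seq (dart G)) :
    elementary_loop m r ->
    contractible m (s1 ++ r ++ s2) -> contractible m (s1 ++ s2).

(* [G] is the graph of the regular {m,m} tiling of the plane.  The plane is the
   only connected, simply connected surface that is tiled by infinitely many
   compact faces in a locally finite way; these conditions determine the tiling
   up to isomorphism, the infinite graph G(m) itself existing for m >= 4. *)
Record regular_plane_tiling (m : nat) (G : rotation_system) : Prop := {
  tiling_infinite : infinite_set [set: edge G];
  tiling_connected : forall e f : edge G, open_cluster (fun=> true) e f;
  tiling_degree : forall d : dart G, orbit_length (@rot G) d m;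
  tiling_face_length : forall d : dart G, orbit_length (@fnext G) d m;
  tiling_simply_connected :
    forall s : seq (dart G), cycle (@follows G) s -> contractible m s
}.

(** * Bond percolation *)

Definition edge_open_events (G : rotation_system) : set (set (edge G -> bool)) :=
  [set [set w : edge G -> bool | w e] | e in [set: edge G]].

(* Configurations, with the product sigma-algebra. *)
Notation configuration G := (g_sigma_algebraType (@edge_open_events G)).

(* [P] is the product over the edges of the Bernoulli measures of parameter
   [p], given by its values on cylinders. *)
Definition percolation_measure (R : realType) (G : rotation_system) (p : R)
    (P : probability (configuration G) R) : Prop :=
  forall (s : seq (edge G)) (b : edge G -> bool), uniq s ->
    P [set w : edge G -> bool | forall e, e \in s -> w e = b e] =
      (\prod_(e <- s) (if b e then p else 1 - p))%:E.

Definition critical_probability (R : realType) (G : rotation_system)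
    (e : edge G) : R :=
  inf [set p : R | 0 <= p <= 1 /\
    exists P : probability (configuration G) R, percolation_measure p P /\
      (0 < P [set w : edge G -> bool | infinite_set (open_cluster w e)])%E].

(** * Counting subtrees of the m-regular tree

    The infinite m-regular tree is the Cayley graph of the free product of [m]
    copies of Z/2Z: its vertices are the words over ['I_m] without two equal
    consecutive letters, and the neighbours of a word are obtained by adding or
    removing a first letter.  The fixed vertex is the empty word. *)

Definition tree_vertex (m : nat) (u : seq 'I_m) : bool :=
  sorted (fun i j => i != j) u.

Definition tree_adj (m : nat) (u v : seq 'I_m) : bool :=
  [exists i, (v == i :: u) || (u == i :: v)].

(* A subtree is determined by its vertex set, and has one edge fewer than it
   has vertices. *)
Definition rooted_subtree (m k : nat) : set {fset seq 'I_m} :=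
  [set S | [/\ [::] \in S,
      #|` S|%fset = k.+1,
      forall u, u \in S -> tree_vertex u &
      forall u, u \in S -> exists s : seq (seq 'I_m),
        [/\ path (@tree_adj m) [::] s, last [::] s = u & {subset s <= S}]]].

Definition subtree_count (m k : nat) : nat :=
  #|` fset_set (@rooted_subtree m k)|%fset.

(* The polynomial S_n(x) for the m-regular tree. *)
Definition subtree_poly (R : realType) (m n : nat) (x : R) : R :=
  \sum_(k < n.+1) (subtree_count m k)%:R / k.+1%:R * x ^+ k.

(** * The equation *)

Definition bound_equation (R : realType) (m : nat) (p : R) : Prop :=
  1 - 4 / m%:R =
  (1 - 2 * p) *
  (4 / (m%:R * p) *
     (1 - (1 - p) ^+ m * subtree_poly m (m - 2) (p * (1 - p) ^+ (m - 2))) - 1).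

Definition nonzero_solution (R : realType) (m : nat) (p : R) : Prop :=
  [/\ 0 <= p <= 1, p != 0 & bound_equation m p].

Definition smallest_nonzero_solution (R : realType) (m : nat) (p : R) : Prop :=
  nonzero_solution m p /\ forall q : R, nonzero_solution m q -> p <= q.

(* Main.v *)
(**
Let [r(p)] be the expected rank density of the open subgraph in the graphic
matroid, that is [2/m] times [1 - kappa(p)], where [kappa(p)] is the expectation
of the inverse of the number of vertices of the cluster of a given vertex.
Its derivative [h] is the probability that the ends of an edge are connected
neither by open paths avoiding this edge nor through infinity. It is
nonincreasing, so [r] is concave. If there is no percolation at [p], then for
[t <= p] a connection between the ends of an edge encloses a finite dual
cluster, so by self-duality [h(t) + h(1 - t) >= 1] and
[r(1 - p) - r(p) <= r(1) - p], with [r(1) <= 2/m]. With concavity on [[p, 1]]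
this gives [p (1 - p) - 2 p / m <= (1 - 2 p) r(p)]. Finally, exploring a cluster
shows that [kappa(p)] is at least its value for the m-regular tree, even
restricted to clusters with at most [m] vertices; stopping at [m - 1] vertices
gives the polynomial of the statement, and the remaining term makes the
inequality strict. Hence the equation has no root [p < 1/2] below the threshold.

To keep everything polynomial in [p], sizes are truncated at a large [n]: the
cluster functional [1/size] becomes [1/min(size, n)], and the inequalities hold
up to errors that vanish as [n] grows. Sizes are counted in darts, which
multiplies the number of vertices by [m].
*)
Require Import Defs.
From HB Require Import structures.
From mathcomp Require Import all_boot all_order all_algebra.
From mathcomp Require Import finmap.
From mathcomp Require Import all_classical all_reals all_analysis.
From mathcomp Require Import measurable_realfun polyrcf zify lra.
Import Order.TTheory GRing.Theory Num.Theory.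
Import numFieldNormedType.Exports.
Set Implicit Arguments.
Unset Strict Implicit.
Unset Printing Implicit Defensive.
Local Open Scope ring_scope.

(** Transitivity, self-duality and a Jordan property of [G] are not given; all three are drawn from
    the triviality of closed walks. Any system of moves obeying the relations of [rot] and [rev]
    receives a map from the darts, and modulo 2 a closed walk bounds finitely many faces. As degree
    and face length agree, exchanging vertices and faces is one such map.

    Truncation makes every expectation a polynomial in the parameter: Russo's formula becomes an
    identity of polynomials and the mean value theorem replaces integration. Measures enter only
    twice: to know that [p] carries a percolation measure, without which the absence of percolation
    at [p] would be void, and to turn this absence into a small probability for large clusters. The
    price is an error for each [n]; since [p] is fixed and the comparison with the tree is strict
    there, the error can be made smaller than the gap. *)

Section TruncatedSize.
Context {T : choiceType}.
Implicit Types (C : set T) (n k : nat).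

Definition contains_uniq C k : Prop :=
  exists s : seq T, [/\ uniq s, size s = k & forall x, x \in s -> C x].

(* The truncation at [n] makes the size of a cluster, even of an infinite one,
   a function of finitely many edges. *)
Definition csize n C : nat := \max_(k < n.+1 | `[< contains_uniq C k >]) k.

Lemma contains_uniqW C k k' : (k' <= k)%N -> contains_uniq C k -> contains_uniq C k'.
Proof.
move=> le_k [s [us ss sC]]; exists (take k' s); split.
- exact: take_uniq.
- by rewrite size_takel // ss.
- by move=> x /mem_take /sC.
Qed.

Lemma leq_csize n C k : (k <= csize n C)%N <-> (k <= n)%N /\ contains_uniq C k.
Proof.
split=> [le_k|[le_kn Ck]]; last first.
  have lt_k : (k < n.+1)%N by [].
  have Pk : `[< contains_uniq C (Ordinal lt_k) >] by apply/asboolP.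
  exact: (@leq_bigmax_cond _ (fun i : 'I_n.+1 => `[< contains_uniq C i >]) (fun i => nat_of_ord i) _ Pk).
have [i Pi ei] : exists2 i : 'I_n.+1, contains_uniq C i & csize n C = i.
  rewrite /csize.
  have P0 : (0 < #|[pred i : 'I_n.+1 | `[< contains_uniq C i >]]|)%N.
    by apply/card_gt0P; exists ord0; apply/asboolP; exists [::]; split.
  have [i Pi ei] := eq_bigmax_cond (fun i : 'I_n.+1 => nat_of_ord i) P0.
  exists i; last exact: ei.
  exact: asboolW Pi.
rewrite ei in le_k; split; last exact: contains_uniqW le_k Pi.
by rewrite (leq_trans le_k) // -ltnS.
Qed.

Lemma csize_le n C : (csize n C <= n)%N.
Proof. by have /leq_csize[] := leqnn (csize n C). Qed.

Lemma csize_mono n C C' : (forall x, C x -> C' x) -> (csize n C <= csize n C')%N.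
Proof.
move=> sub; apply/leq_csize; split; first exact: csize_le.
have /leq_csize[_ [s [us ss sC]]] := leqnn (csize n C).
by exists s; split=> // x /sC/sub.
Qed.

Lemma eq_csize n C C' : (forall x, C x <-> C' x) -> csize n C = csize n C'.
Proof.
by move=> eqC; apply/eqP; rewrite eqn_leq !csize_mono // => x /eqC.
Qed.

Lemma csize_gt0 n C x : (0 < n)%N -> C x -> (0 < csize n C)%N.
Proof.
move=> n0 Cx; apply/leq_csize; split=> //.
by exists [:: x]; split=> // y; rewrite inE => /eqP ->.
Qed.

Lemma csize_size n C s : uniq s -> (forall x, x \in s -> C x) ->
  (minn n (size s) <= csize n C)%N.
Proof.
move=> us sC; apply/leq_csize; split; first exact: geq_minl.
apply: (contains_uniqW (geq_minr n (size s))).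
by exists s.
Qed.

Lemma csize_le_size n C (s : seq T) : (forall x, C x -> x \in s) ->
  (csize n C <= size s)%N.
Proof.
move=> Cs; have /leq_csize[_ [s' [us <- s'C]]] := leqnn (csize n C).
by apply: uniq_leq_size => // x /s'C/Cs.
Qed.

(** A list of maximal length exhausts [C], as one more element would still fit below the
    truncation. *)
Lemma csize_enum n C : (csize n C < n)%N ->
  exists s : seq T, [/\ uniq s, size s = csize n C & forall x, C x <-> x \in s].
Proof.
move=> lt_n; have /leq_csize[_ [s [us ss sC]]] := leqnn (csize n C).
exists s; split=> // x; split=> [Cx|/sC //].
apply/negPn/negP => xs.
have : (minn n (size (x :: s)) <= csize n C)%N.
  apply: csize_size; first by rewrite /= xs.
  by move=> y; rewrite inE => /orP[/eqP->|/sC].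
by rewrite /= ss (minn_idPr lt_n) ltnn.
Qed.

Lemma csize_disjointU n C C' : (forall x, C x -> ~ C' x) ->
  csize n (fun x => C x \/ C' x) = minn n (csize n C + csize n C').
Proof.
move=> dis; apply/eqP; rewrite eqn_leq; apply/andP; split.
  rewrite leq_min csize_le /=.
  have /leq_csize[le_n [s [us ss sC]]] := leqnn (csize n (fun x => C x \/ C' x)).
  rewrite -ss -(count_predC (fun x => `[< C x >]) s) -!size_filter.
  rewrite -ss in le_n; apply: leq_add.
    rewrite -{1}(minn_idPr (leq_trans _ le_n : size (seq.filter (fun x => `[< C x >]) s) <= n)%N).
      apply: csize_size; first exact: filter_uniq.
      by move=> x; rewrite mem_filter => /andP[/asboolP].
    by rewrite size_filter count_size.
  rewrite -{1}(minn_idPr (leq_trans _ le_n : size (seq.filter (predC (fun x => `[< C x >])) s) <= n)%N).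
    apply: csize_size; first exact: filter_uniq.
    by move=> x; rewrite mem_filter => /andP[/asboolP nC /sC[]].
  by rewrite size_filter count_size.
have /leq_csize[_ [s [us ss sC]]] := leqnn (csize n C).
have /leq_csize[_ [s' [us' ss' sC']]] := leqnn (csize n C').
rewrite -ss -ss' -size_cat; apply: csize_size.
  rewrite cat_uniq us us' andbT /=; apply/hasPn => x /sC' Cx'.
  by apply/negP => /sC /dis.
by move=> x; rewrite mem_cat => /orP[/sC|/sC']; [left|right].
Qed.

Lemma csize_image n C (f : T -> T) : injective f ->
  csize n (fun y => exists2 x, C x & f x = y) = csize n C.
Proof.
move=> finj; apply/eqP; rewrite eqn_leq; apply/andP; split.
  apply/leq_csize; split; first exact: csize_le.
  have /leq_csize[_ [s [us <- sC]]] := leqnn (csize n (fun y => exists2 x, C x & f x = y)).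
  have [s' es'] : exists s' : seq T, s = map f s' /\ forall x, x \in s' -> C x.
    elim: s sC {us} => [|y s IH] sC; first by exists [::].
    have [s' [-> Cs']] := IH (fun x xs => sC x (mem_behead (s := y :: s) xs)).
    have [x Cx <-] := sC y (mem_head _ _).
    by exists (x :: s'); split=> // z; rewrite inE => /orP[/eqP->|/Cs'].
  case: es' => es Cs'; exists s'; split=> //.
    by rewrite es map_inj_uniq in us.
  by rewrite es size_map.
have /leq_csize[le_n [s [us ss sC]]] := leqnn (csize n C).
apply/leq_csize; split => //; exists (map f s); split.
- by rewrite map_inj_uniq.
- by rewrite size_map.
- by move=> y /mapP[x /sC Cx ->]; exists x.
Qed.

End TruncatedSize.

(** * Words in the two moves of a dart, and clusters of darts *)

(* In a word, [false] is a turn around the vertex and [true] crosses the edge. *)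
Section Words.
Context {X : Type}.
Variables (m : nat) (a b : X -> X).
Implicit Types (u v : seq bool) (x y : X).

Fixpoint run u x : X :=
  if u is c :: u' then run u' (if c then b x else a x) else x.

Fixpoint crossed u x : seq X :=
  if u is c :: u' then (if c then x :: crossed u' (b x) else crossed u' (a x))
  else [::].

Lemma run_cat u v x : run (u ++ v) x = run v (run u x).
Proof. by elim: u x => //= c u IH x; rewrite IH. Qed.

Lemma crossed_cat u v x : crossed (u ++ v) x = crossed u x ++ crossed v (run u x).
Proof. by elim: u x => //= -[] u IH x /=; rewrite IH. Qed.

Lemma run_nseq k x : run (nseq k false) x = iter k a x.
Proof. by elim: k x => //= k IH x; rewrite IH -iterSr. Qed.

(** The inverse in the group generated by the moves: [a] has order dividing [m], so a turn is undone
    by [m.-1] turns. *)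
Fixpoint inv_word u : seq bool :=
  if u is c :: u' then inv_word u' ++ (if c then [:: true] else nseq m.-1 false)
  else [::].

Hypothesis m_gt0 : (0 < m)%N.
Hypothesis am : forall x, iter m a x = x.
Hypothesis bb : forall x, b (b x) = x.

Lemma iter_pred_order x : iter m.-1 a (a x) = x.
Proof. by rewrite -iterSr prednK. Qed.

Lemma run_inv_word u x : run (inv_word u) (run u x) = x.
Proof.
elim: u x => //= c u IH x; rewrite run_cat IH; case: c => /=; first exact: bb.
by rewrite run_nseq iter_pred_order.
Qed.

Lemma run_inj u : injective (run u).
Proof. exact: can_inj (run_inv_word u). Qed.

Lemma iter_order_mod k x : iter k a x = iter (k %% m)%N a x.
Proof.
rewrite {1}(divn_eq k m) addnC iterD; congr iter.
by elim: (k %/ m)%N => // j IH; rewrite mulSn iterD IH.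
Qed.

End Words.

Fixpoint words n : seq (seq bool) :=
  if n is n'.+1 then
    [::] :: map (cons true) (words n') ++ map (cons false) (words n')
  else [:: [::]].

Lemma mem_words n u : (u \in words n) = (size u <= n)%N.
Proof.
elim: n u => [|n IH] [|c u] //=; rewrite inE /= mem_cat ltnS -IH.
have inj (d : bool) : injective (cons d) by move=> ? ? [].
have nin (d : bool) : (c :: u \in map (cons d) (words n)) = (c == d) && (u \in words n).
  apply/mapP/andP => [[v vn [-> ->]]|[/eqP-> un]]; last by exists u.
  by rewrite eqxx.
by rewrite !nin; case: c {nin}; rewrite /= ?orbF.
Qed.

Definition flip (E : Type) (x : E * bool) : E * bool := (x.1, ~~ x.2).

Lemma flipK (E : Type) (x : E * bool) : flip (flip x) = x.
Proof. by case: x => e b; rewrite /flip /= negbK. Qed.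

Lemma same_edge (E : eqType) (x y : E * bool) : x.1 = y.1 -> x = y \/ x = flip y.
Proof. by case: x y => e [] [f []] /= ->; [left|right|right|left]. Qed.

Definition upd (E : eqType) (w : E -> bool) (e : E) (b : bool) : E -> bool :=
  fun f => if f == e then b else w f.

Definition local_on (E : eqType) (T : Type) (B : seq E) (F : (E -> bool) -> T) :=
  forall w w', {in B, w =1 w'} -> F w = F w'.

Section Clusters.
Context {E : countType}.
Implicit Types (e : E) (w : E -> bool) (x y z d : E * bool).

(** The rotation is a parameter: [rot] gives clusters of vertices, [fnext] gives clusters of faces,
    that is, of the dual graph. *)
Inductive cluster (a : E * bool -> E * bool) w d : E * bool -> Prop :=
| cluster_refl : cluster a w d d
| cluster_turn x : cluster a w d x -> cluster a w d (a x)
| cluster_cross x : cluster a w d x -> w x.1 -> cluster a w d (flip x).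

Variables (m : nat) (a : E * bool -> E * bool).
Hypothesis m_gt0 : (0 < m)%N.
Hypothesis am : forall x, iter m a x = x.

Lemma cluster_trans w x y z : cluster a w x y -> cluster a w y z -> cluster a w x z.
Proof.
move=> xy; elim=> // t _ xt; first exact: cluster_turn.
by move=> wt; apply: cluster_cross.
Qed.

Lemma cluster_iter w x k : cluster a w x (iter k a x).
Proof. by elim: k => [|k IH]; [exact: cluster_refl|exact: cluster_turn]. Qed.

Lemma cluster_sym w x y : cluster a w x y -> cluster a w y x.
Proof.
elim=> [|t _ xt|t _ xt wt]; first exact: cluster_refl.
  by apply: cluster_trans xt; rewrite -{2}(iter_pred_order m_gt0 am t); exact: cluster_iter.
apply: cluster_trans xt; rewrite -{2}(flipK t).
by apply: cluster_cross => //; exact: cluster_refl.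
Qed.

Lemma cluster_mono w w' x y : (forall e, w e -> w' e) ->
  cluster a w x y -> cluster a w' x y.
Proof.
move=> ww'; elim=> [|t _ xt|t _ xt /ww' wt]; first exact: cluster_refl.
  exact: cluster_turn.
exact: cluster_cross.
Qed.

Let step w x y := (y == a x) || (w x.1 && (y == flip x)).

Lemma cluster_path w d x : cluster a w d x ->
  exists s, path (step w) d s /\ last d s = x.
Proof.
elim=> [|t _ [s [ps <-]]|t _ [s [ps <-]] wt]; first by exists [::].
  exists (rcons s (a (last d s))); rewrite rcons_path ps last_rcons /step eqxx.
  by [].
exists (rcons s (flip (last d s))); rewrite rcons_path ps last_rcons /step wt eqxx.
by rewrite orbT.
Qed.

Lemma path_cluster w d s : path (step w) d s -> forall x, x \in d :: s -> cluster a w d x.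
Proof.
elim: s d => [|y s IH] d /=.
  by move=> _ x; rewrite inE => /eqP->; exact: cluster_refl.
case/andP => dy /IH{}IH x; rewrite inE => /orP[/eqP->|/IH]; first exact: cluster_refl.
apply: cluster_trans; case/orP: dy => [/eqP->|/andP[wd /eqP->]].
  by apply: cluster_turn; exact: cluster_refl.
by apply: cluster_cross => //; exact: cluster_refl.
Qed.

Lemma path_word w d s : path (step w) d s ->
  exists u, [/\ size u = size s, run a (@flip E) u d = last d s &
    all (fun x => w x.1) (crossed a (@flip E) u d)].
Proof.
elim: s d => [|y s IH] d /=; first by exists [::].
case/andP => dy /IH[u [su ru au]]; case/orP: dy => [/eqP ey|/andP[wd /eqP ey]].
  by exists (false :: u); rewrite /= su -ey.
by exists (true :: u); rewrite /= su -ey wd.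
Qed.

(** A path without repetition is no longer than the cluster allows, so finitely many words suffice
    for small clusters. *)
Lemma cluster_word n w d x : (csize n (cluster a w d) < n)%N -> cluster a w d x ->
  exists u, [/\ (size u < n)%N, run a (@flip E) u d = x &
    all (fun x => w x.1) (crossed a (@flip E) u d)].
Proof.
move=> lt_n /cluster_path[s [ps ls]].
case/shortenP: ps ls => s' ps' us' _ <-.
have [u [su ru au]] := path_word ps'.
exists u; split=> //; rewrite su.
have := csize_size n us' (path_cluster ps').
case: (leqP n (size s')) => // le_ns.
by rewrite (minn_idPl (leqW le_ns)) leqNgt lt_n.
Qed.

Definition ball n d : seq E := undup [seq (run a (@flip E) u d).1 | u <- words n].

(** When the cluster for [w'] is small, all its darts are within [n] moves of [d], so following [w]
    from [d] only ever consults edges on which the two configurations agree. *)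
Lemma cluster_local n d w w' x : {in ball n d, w =1 w'} ->
  (csize n (cluster a w' d) < n)%N -> cluster a w d x -> cluster a w' d x.
Proof.
move=> ww' lt_n; elim=> [|y _ IH|y _ IH wy].
- exact: cluster_refl.
- exact: cluster_turn.
- apply: cluster_cross => //; rewrite -ww' // mem_undup.
  have [u [su <- _]] := cluster_word lt_n IH.
  by apply: (map_f (fun u => (run a (@flip E) u d).1)); rewrite mem_words ltnW.
Qed.

Lemma csize_cluster_local n d : local_on (ball n d) (fun w => csize n (cluster a w d)).
Proof.
suff le w w' : {in ball n d, w =1 w'} ->
    (csize n (cluster a w d) <= csize n (cluster a w' d))%N.
  by move=> w w' ww'; apply/eqP; rewrite eqn_leq !le // => e /ww'.
move=> ww'; case: (ltnP (csize n (cluster a w' d)) n) => [lt_n|]; last first.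
  exact: leq_trans (csize_le _ _).
by apply: csize_mono => x; exact: cluster_local ww' lt_n.
Qed.

Lemma cluster_upd_merge w x y z :
  cluster a (upd w x.1 false) x y \/ cluster a (upd w x.1 false) (flip x) y ->
  cluster a (upd w x.1 true) y z <->
  (cluster a (upd w x.1 false) x z \/ cluster a (upd w x.1 false) (flip x) z).
Proof.
set w0 := upd w _ false; set w1 := upd w _ true => Hy.
have w01 e : w0 e -> w1 e by rewrite /w0 /w1 /upd; case: eqP.
have xfx : cluster a w1 x (flip x).
  by apply: cluster_cross; [exact: cluster_refl|rewrite /w1 /upd eqxx].
have hub t : cluster a w0 x t \/ cluster a w0 (flip x) t -> cluster a w1 x t.
  by case=> /(cluster_mono w01) // ?; exact: cluster_trans xfx _.
split=> [|/hub xz]; last first.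
  by apply: cluster_trans xz; apply: cluster_sym; exact: hub.
elim=> // t _ IH; first by case: IH => ?; [left|right]; exact: cluster_turn.
rewrite /w1 /upd; case: eqP => [te _|ne wt]; last first.
  have w0t : w0 t.1 by rewrite /w0 /upd; case: eqP.
  by case: IH => ?; [left|right]; exact: cluster_cross.
case: (same_edge te) => ->; first by right; exact: cluster_refl.
by rewrite flipK; left; exact: cluster_refl.
Qed.

Lemma cluster_upd_other w x y z :
  ~ cluster a (upd w x.1 false) x y -> ~ cluster a (upd w x.1 false) (flip x) y ->
  cluster a (upd w x.1 true) y z <-> cluster a (upd w x.1 false) y z.
Proof.
set w0 := upd w _ false; set w1 := upd w _ true => nx nfx.
split; last by apply: cluster_mono => e; rewrite /w0 /w1 /upd; case: eqP.
elim=> [|t _ IH|t _ IH]; [exact: cluster_refl|exact: cluster_turn|].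
rewrite /w1 /upd; case: eqP => [te _|ne wt]; last first.
  by apply: cluster_cross => //; rewrite /w0 /upd; case: eqP.
by have := cluster_sym IH; case: (same_edge te) => ->.
Qed.

End Clusters.

Section Transport.
Context {E : countType}.
Variables (m : nat) (a a' : E * bool -> E * bool) (f : E * bool -> E * bool).
Hypotheses (f_inj : injective f) (f_turn : forall x, f (a x) = a' (f x))
  (f_flip : forall x, f (flip x) = flip (f x)).

Definition edge_map (e : E) : E := (f (e, true)).1.

Lemma edge_mapE x : (f x).1 = edge_map x.1.
Proof.
case: x => e []; rewrite /edge_map //=.
by rewrite -[(e, false)]/(flip (e, true)) f_flip.
Qed.

Lemma edge_map_inj : injective edge_map.
Proof.
move=> e e' /same_edge[/f_inj[]//|]; rewrite -f_flip => /f_inj[] //.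
Qed.

(** Two rotations are allowed, so that this covers the duality map as well as automorphisms. *)
Lemma cluster_transport w d y :
  cluster a' w (f d) y <-> exists2 x, cluster a (w \o edge_map) d x & f x = y.
Proof.
split=> [|[x dx <-]].
  elim=> [|t _ [x dx <-]|t _ [x dx <-] wt].
  - by exists d => //; exact: cluster_refl.
  - by exists (a x); [exact: cluster_turn|exact: f_turn].
  - exists (flip x); last exact: f_flip.
    by apply: cluster_cross => //=; rewrite -edge_mapE.
elim: dx => [|t _ IH|t _ IH /= wt]; first exact: cluster_refl.
  by rewrite f_turn; exact: cluster_turn.
by rewrite f_flip; apply: cluster_cross => //; rewrite edge_mapE.
Qed.

Lemma csize_cluster_transport n w d :
  csize n (cluster a' w (f d)) = csize n (cluster a (w \o edge_map) d).
Proof.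
rewrite -[RHS](csize_image n (cluster a (w \o edge_map) d) f_inj); apply: eq_csize => y.
exact: cluster_transport.
Qed.

End Transport.

(** * Symmetries and separation in a simply connected tiling *)

Section Tiling.
Context {m : nat} {G : rotation_system} (m_gt1 : (1 < m)%N)
  (hG : regular_plane_tiling m G).
Let D : Type := (edge G * bool)%type.
Let r : D -> D := @Defs.rot G.
Let fl : D -> D := @flip (edge G).

Let m_gt0 : (0 < m)%N := ltnW m_gt1.

Lemma iter_rot (x : D) : iter m r x = x.
Proof. by have [] := tiling_degree hG x. Qed.

Lemma iter_fnext (x : D) : iter m (@fnext G) x = x.
Proof. by have [] := tiling_face_length hG x. Qed.

Lemma iter_rot_dvd k (x : D) : iter k r x = x -> (m %| k)%N.
Proof.
rewrite (iter_order_mod iter_rot) => fix_x; have [_ /(_ (k %% m)%N)] := tiling_degree hG x.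
rewrite ltn_mod m_gt0 andbT /dvdn; case: (posnP (k %% m)%N) => [-> //|_ /(_ isT)].
by move/(_ fix_x).
Qed.

Lemma run_reach (x0 x : D) : exists u, run r fl u x0 = x.
Proof.
have : cluster r (fun=> true) x0 x.
  have xe : forall b, cluster r (fun=> true) x0 (x.1, b).
    elim: (tiling_connected hG x0.1 x.1) => [_|e f _ IH [b [c [k ek]]] _].
      have : cluster r (fun=> true) x0 (flip x0) by apply: cluster_cross => //; exact: cluster_refl.
      by case: (x0) => e [] ? []//; exact: cluster_refl.
    have fc : cluster r (fun=> true) x0 (f, c).
      rewrite -ek; apply: cluster_trans (IH b) _; exact: cluster_iter.
    by case: c fc {ek} => fc [] //; exact: (cluster_cross fc).
  by case: x xe.
elim=> [|y _ [u <-]|y _ [u <-] _]; first by exists [::].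
  by exists (u ++ [:: false]); rewrite run_cat.
by exists (u ++ [:: true]); rewrite run_cat.
Qed.

(* [al] and [be] satisfy the relations of [rot] and [rev], so that a walk of
   darts transports points of [Y]. Elementary loops transport trivially, hence
   so does every closed walk: [rot] and [rev] satisfy no further relation. *)
Section Lift.
Context {Y : Type}.
Variables (al be : Y -> Y).
Hypotheses (alm : forall y, iter m al y = y) (bebe : forall y, be (be y) = y)
  (albem : forall y, iter m (fun y => al (be y)) y = y).
Implicit Types (z : D * Y) (s : seq D).

(* States [(x, y)] up to turning around the vertex of [x]. *)
Definition near_by z z' : Prop :=
  exists k, iter k r z.1 = z'.1 /\ iter k al z.2 = z'.2.

Lemma near_refl z : near_by z z. Proof. by exists 0%N. Qed.

Lemma near_trans z1 z2 z3 : near_by z1 z2 -> near_by z2 z3 -> near_by z1 z3.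
Proof.
by rewrite /near_by => -[k [<- <-]] [j [<- <-]]; exists (j + k)%N; rewrite !iterD.
Qed.

Lemma iter_back (X : Type) (f : X -> X) k (x : X) : (forall x, iter m f x = x) ->
  iter (m - k %% m)%N f (iter k f x) = x.
Proof.
move=> fm; rewrite (iter_order_mod fm k) -iterD subnK ?fm //.
by rewrite ltnW // ltn_mod.
Qed.

Lemma near_sym z1 z2 : near_by z1 z2 -> near_by z2 z1.
Proof.
rewrite /near_by => -[k [<- <-]]; exists (m - k %% m)%N.
by rewrite !iter_back //; exact: iter_rot.
Qed.

(** Turning back to the same dart takes a multiple of [m] turns, because the degree is exactly [m],
    and [al] is then trivial too. *)
Lemma near_fun z1 z2 : near_by z1 z2 -> z1.1 = z2.1 -> z1.2 = z2.2.
Proof.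
case: z1 z2 => x y [x' y'] [k /= [+ ey]] ex; rewrite -{}ex => /iter_rot_dvd/eqP mk.
by rewrite -ey (iter_order_mod alm) mk.
Qed.

(** A walk records only the darts that it crosses; [near_by] supplies the turns made between two
    crossings. *)
Fixpoint lift z s z' : Prop :=
  if s is t :: s' then exists y, near_by z (t, y) /\ lift (fl t, be y) s' z'
  else near_by z z'.

Lemma lift_near z1 z2 z3 z4 s : near_by z1 z2 -> lift z2 s z3 -> near_by z3 z4 -> lift z1 s z4.
Proof.
elim: s z1 z2 => [|t s IH] z1 z2 /=.
  by move=> z12 z23 z34; exact: near_trans (near_trans z12 z23) z34.
move=> z12 [y [z2t ty]] z34; exists y; split; first exact: near_trans z2t.
by apply: IH ty z34; exact: near_refl.
Qed.

Lemma lift_cat z1 z2 s s' : lift z1 (s ++ s') z2 <-> exists2 z, lift z1 s z & lift z s' z2.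
Proof.
elim: s z1 => [|t s IH] z1 /=.
  split=> [z12|[z z1z]]; first by exists z1 => //; exact: near_refl.
  by move/lift_near; move/(_ _ _ z1z); apply; exact: near_refl.
split=> [[y [z1y /IH[z]]]|[z [y [z1y yz]]] zz2]; first by exists z => //; exists y.
by exists y; split=> //; apply/IH; exists z.
Qed.

Lemma lift_face z d y j z' : near_by z (d, y) -> lift z (traject (@fnext G) d j) z' ->
  near_by z' (iter j (@fnext G) d, iter j (fun y => al (be y)) y).
Proof.
elim: j z d y => [|j IH] z d y zd.
  by move=> zz'; apply: near_trans zd; exact: near_sym.
case=> y' [zy']; have -> : y' = y.
  by apply: (near_fun (z1 := (d, y')) (z2 := (d, y))) => //;
    apply: near_trans zd; exact: near_sym.
by rewrite !iterSr; apply: IH; exists 1%N.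
Qed.

Lemma lift_elementary z s z' : elementary_loop m s -> lift z s z' -> near_by z z'.
Proof.
move=> [d [->|->]] /=.
  move=> [y [zd [y1 [dy1 y1z']]]]; apply: near_trans zd _.
  have e1 := near_fun dy1 erefl; rewrite /= in e1.
  by move: y1z'; rewrite -e1 bebe /fl flipK.
move=> L; have [y zd] : exists y, near_by z (d, y).
  by move: L; rewrite -(prednK m_gt0) /= => -[y [zd _]]; exists y.
have := lift_face zd L; rewrite iter_fnext albem => z'd.
by apply: near_trans zd _; exact: near_sym.
Qed.

Lemma lift_ends z1 z2 z1' z2' s : s <> [::] -> lift z1 s z1' -> lift z2 s z2' ->
  exists k, iter k r z1.1 = z2.1.
Proof.
case: s => // t s _ /= [y [z1t _]] [y' [z2t _]].
have [k [e1 _]] := z1t; have [k' [e2 _]] := near_sym z2t.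
by exists (k' + k)%N; rewrite iterD e1.
Qed.

Lemma lift_ends' z1 z2 z1' z2' s : s <> [::] -> lift z1 s z1' -> lift z2 s z2' ->
  exists k, iter k r z1'.1 = z2'.1.
Proof.
elim: s z1 z2 => // t s IH z1 z2 _ /= [y [_ l1]] [y' [_ l2]].
case: s IH l1 l2 => [|t' s] IH; last by apply: IH.
rewrite /= => l1 l2; have [k [e1 _]] := near_sym l1; have [k' [e2 _]] := l2.
by exists (k' + k)%N; rewrite iterD e1.
Qed.

Definition joins (x : D) s (x' : D) : Prop := forall y, exists y', lift (x, y) s (x', y').

Lemma joins_near x s x' z : joins x s x' -> (exists k, iter k r x = z.1) ->
  exists y', lift z s (x', y').
Proof.
move=> j [k e]; have [y'] := j (iter (m - k %% m)%N al z.2).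
set z0 := (x, _) => l; exists y'.
apply: lift_near l (near_refl _); apply: near_sym; exists k; split=> //=.
rewrite -iterD addnC iterD; have := iter_back k z.2 alm.
by rewrite -!iterD addnC.
Qed.

Lemma lift_joins z s z' : lift z s z' -> joins z.1 s z'.1.
Proof.
elim: s z => [|t s IH] z /=.
  by move=> [k [e _]] y; exists (iter k al y), k.
move=> [y0 [[k [e _]] /IH j]] y.
by have [y' l] := j (be (iter k al y)); exists y', (iter k al y); split=> //; exists k.
Qed.

Lemma lift_follows z t s z' : lift z (t :: s) z' ->
  path (@follows G) t s /\ exists k, iter k r (fl (last t s)) = z'.1.
Proof.
elim: s z t => [|t' s IH] z t /=.
  by move=> [y [_ [k [e _]]]]; split=> //; exists k.
move=> [y [_ [y' [ty' l]]]].
have [p e] := IH (t', y') t' (ex_intro _ y' (conj (near_refl _) l)).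
split=> //; rewrite p andbT; apply/asboolP; have [k [ek _]] := ty'.
by exists k.
Qed.

Lemma lift_cycle z s z' : lift z s z' -> z.1 = z'.1 -> cycle (@follows G) s.
Proof.
case: s => // t s l e; have [p [k ek]] := lift_follows l.
rewrite /= rcons_path p /=; apply/asboolP.
have [y [[j [ej _]] _]] := l.
by exists (j + k)%N; rewrite iterD [iter k _ _]ek -e.
Qed.

Lemma path_lift t s y : path (@follows G) t s ->
  exists y', lift (t, y) (t :: s) (fl (last t s), y').
Proof.
elim: s t y => [|t' s IH] t y /=.
  by move=> _; exists (be y), y; split; exact: near_refl.
move=> /andP[/asboolP[k ek] /(IH t' (iter k al (be y)))[y' l]].
exists y', y; split; first exact: near_refl.
apply: lift_near l (near_refl _); exists k; split=> //.
Qed.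

Lemma cycle_joins s : cycle (@follows G) s -> Y -> exists x, joins x s x.
Proof.
case: s => [|t s]; first by move=> _ y; have := tiling_infinite hG;
  case: (pselect (exists x : D, True)) => [[x _] _|nx inf]; [exists x => y'; exists y'; exact: near_refl|];
  exfalso; apply: inf; rewrite (_ : setT = set0) // -subset0 => e _; apply: nx; exists (e, true).
rewrite /= rcons_path => /andP[p /asboolP[k ek]] y0; exists t => y.
have [y' l] := path_lift y p; exists (iter k al y').
by apply: (lift_near (near_refl _) l); exists k.
Qed.

(** The existence half serves the deletion rule: the deleted loop has to be put back into a lift, so
    it must be known to start at the vertex reached there. *)
Lemma contractible_lift s : contractible m s -> Y ->
  (exists x, joins x s x) /\ forall z z', lift z s z' -> near_by z z'.
Proof.
move=> cs y0; elim: cs => [|s1 t s2 el cyc _ [_ IH]|s1 t s2 el _ [[x jx] IH]].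
- by split; first exact: (cycle_joins (s := [::])).
- split; first exact: cycle_joins.
  move=> z z' /lift_cat[z1 l1 /lift_cat[z2 l2 l3]]; apply: IH.
  apply/lift_cat; exists z1 => //; apply: lift_near l3 (near_refl _).
  exact: lift_elementary el l2.
- have [x0 l0] := jx y0.
  have /lift_cat[z1 l1 /lift_cat[z2 l2 l3]] := l0.
  have n12 := lift_elementary el l2.
  split.
    exists x; apply: (lift_joins (z := (x, y0)) (z' := (x, x0))).
    by apply/lift_cat; exists z1 => //; exact: lift_near l3 (near_refl _).
  move=> z z' /lift_cat[z3 l4 l5].
  (* With both sides empty nothing fixes the starting vertex, but then the remaining walk is empty.
     Otherwise the neighbouring part of the walk determines it. *)
  case: (pselect (s1 = [::] /\ s2 = [::])) => [[e1 e2]|nnil].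
    by move: l4 l5; rewrite e1 e2; exact: near_trans.
  have [k ek] : exists k, iter k r z1.1 = z3.1.
    case: (pselect (s1 = [::])) => [e1|n1]; last exact: lift_ends' l1 l4.
    have n2 : s2 <> [::] by move=> e2; apply: nnil.
    have [k ek] := lift_ends n2 l3 l5; have [j [ej _]] := n12.
    by exists (k + j)%N; rewrite iterD ej.
  have [y' l6] := joins_near (lift_joins l2) (ex_intro _ k ek).
  have n3 := lift_elementary el l6.
  apply: IH; apply/lift_cat; exists z3 => //; apply/lift_cat.
  exists (z2.1, y') => //; apply: lift_near l5 (near_refl _).
  exact: near_sym.
Qed.

Lemma run_lift u x y : lift (x, y) (crossed r fl u x) (run r fl u x, run al be u y).
Proof.
elim: u x y => [|c u IH] x y /=; first exact: near_refl.
case: c => /=; first by exists y; split; [exact: near_refl|exact: IH].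
by apply: lift_near (IH _ _) (near_refl _); exists 1%N.
Qed.

Lemma closed_run u x y : run r fl u x = x -> run al be u y = y.
Proof.
move=> ux; have l := run_lift u x y.
have /(tiling_simply_connected hG)/contractible_lift/(_ y)[_ /(_ _ _ l)] :=
  lift_cycle l (esym ux).
by move/near_fun => /(_ (esym ux)).
Qed.

(** Send [x] to the result of running, from [y0], any word leading from [x0] to [x]; [closed_run]
    makes the choice of the word irrelevant. *)
Lemma equivariant_map (x0 : D) (y0 : Y) : exists f : D -> Y,
  [/\ f x0 = y0, forall x, f (r x) = al (f x) & forall x, f (fl x) = be (f x)].
Proof.
have reach := run_reach x0.
pose word x := projT1 (cid (reach x)).
have wordP x : run r fl (word x) x0 = x := projT2 (cid (reach x)).
have same u v : run r fl u x0 = run r fl v x0 -> run al be u y0 = run al be v y0.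
  move=> uv; apply: (run_inj m_gt0 alm bebe (u := inv_word m v)).
  rewrite (run_inv_word m_gt0 alm bebe) -run_cat; apply: closed_run (x0) _ _.
  by rewrite run_cat uv (run_inv_word m_gt0 iter_rot (@flipK _)).
exists (fun x => run al be (word x) y0); split=> [|x|x].
- by rewrite (same _ [::]).
- by rewrite (same _ (word x ++ [:: false])) ?run_cat //= !wordP.
- by rewrite (same _ (word x ++ [:: true])) ?run_cat //= !wordP.
Qed.

End Lift.

Lemma run_equivariant (Y : Type) (al be : Y -> Y) (f : D -> Y) u x :
  (forall x, f (r x) = al (f x)) -> (forall x, f (fl x) = be (f x)) ->
  f (run r fl u x) = run al be u (f x).
Proof.
move=> fr ff; elim: u x => //= c u IH x.
by rewrite IH; case: c; rewrite ?fr ?ff.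
Qed.

Lemma equivariant_id (f : D -> D) x0 : (forall x, f (r x) = r (f x)) ->
  (forall x, f (fl x) = fl (f x)) -> f x0 = x0 -> forall x, f x = x.
Proof.
move=> fr ff f0 x; have [u <-] := run_reach x0 x.
by rewrite (run_equivariant _ _ fr ff) f0.
Qed.

Lemma automorphism (x y : D) : exists f : D -> D,
  [/\ f x = y, forall z, f (r z) = r (f z) & forall z, f (fl z) = fl (f z)].
Proof.
apply: equivariant_map; [exact: iter_rot|exact: flipK|exact: iter_fnext].
Qed.

Lemma automorphism_inj (f : D -> D) : (forall z, f (r z) = r (f z)) ->
  (forall z, f (fl z) = fl (f z)) -> injective f.
Proof.
move=> fr ff x y exy; have [g [gfx gr gf]] := automorphism (f x) x.
have gfK := equivariant_id (f := g \o f) (x0 := x).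
have {}gfK z : g (f z) = z.
  by apply: gfK => //= t; rewrite ?fr ?ff ?gr ?gf.
by rewrite -(gfK x) exy gfK.
Qed.

(* The equivariant map that exchanges vertices and faces; its square is an
   automorphism fixing [x], hence the identity. *)
Lemma self_duality (x : D) : exists f : D -> D,
  [/\ f x = x, forall z, f (r z) = @fnext G (f z), forall z, f (fl z) = fl (f z)
    & injective f].
Proof.
have fff (y : D) : iter m (fun y => @fnext G (fl y)) y = y.
  rewrite -{2}(iter_rot y); apply: eq_iter => z.
  by rewrite /fnext -[Defs.rev _]/(flip (flip z)) flipK.
have [f [fx fr ff]] := equivariant_map iter_fnext (@flipK _) fff x x.
exists f; split=> //; apply: (can_inj (g := f)) => z.
apply: (equivariant_id (f := f \o f) (x0 := x)) => /= [t|t|]; last by rewrite !fx.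
  by rewrite fr -[fnext (f t)]/(r (fl (f t))) fr ff -[LHS]/(r (fl (fl _))) /fl flipK.
by rewrite !ff.
Qed.

Lemma count_edge (t : seq D) e :
  count (fun x : D => x.1 == e) t = (count_mem (e, true) t + count_mem (e, false) t)%N.
Proof.
elim: t => //= -[e' b] t ->; rewrite !xpair_eqE /=.
by case: (e' == e) b => [] [] /=; lia.
Qed.

Lemma uniq_orbit (f : D -> D) x : (forall x, iter m f x = x) ->
  orbit_length f x m -> uniq (traject f x m).
Proof.
move=> fm [_ min]; rewrite -(prednK m_gt0) looping_uniq; apply/negP => /trajectP[i lt_i ei].
have [] := min (m.-1 - i)%N.
  by rewrite subn_gt0 lt_i /= (leq_ltn_trans (leq_subr _ _)) // prednK.
apply: (can_inj (g := iter (m - i %% m)%N f) (f := iter i f)).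
  by move=> y; exact: iter_back fm.
by rewrite -iterD subnKC ?(ltnW lt_i) // ei.
Qed.

(* Modulo 2, a closed walk is the boundary of a finite set of faces. *)
Lemma contractible_face_set (s : seq D) : contractible m s ->
  exists A : D -> bool, [/\ exists l : seq D, forall x, A x -> x \in l,
    forall x, A (@fnext G x) = A x
    & forall e, A (e, true) (+) A (e, false) = odd (count (fun x => x.1 == e) s)].
Proof.
have elem (t : seq D) : elementary_loop m t ->
  exists A : D -> bool, [/\ exists l : seq D, forall x, A x -> x \in l,
    forall x, A (@fnext G x) = A x
    & forall e, A (e, true) (+) A (e, false) = odd (count (fun x => x.1 == e) t)].
  move=> [d [->|->]].
    exists (fun=> false); split=> //; first by exists [::].
    by move=> e /=; case: eqP.
  exists (fun x => x \in traject (@fnext G) d m); split; first by exists (traject (@fnext G) d m).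
    move=> x; apply/trajectP/trajectP => -[i lt_i ei].
      case: i lt_i ei => [|i] lt_i ei.
        exists m.-1; first by rewrite prednK.
        by rewrite -{1}(iter_pred_order m_gt0 iter_fnext x) ei.
      exists i; first exact: ltnW.
      by rewrite -{1}(iter_pred_order m_gt0 iter_fnext x) ei /= (iter_pred_order m_gt0 iter_fnext).
    case: (ltnP i.+1 m) => [lt_im|le_mi]; first by exists i.+1; rewrite // ei.
    have em : i.+1 = m by apply/eqP; rewrite eqn_leq lt_i le_mi.
    exists 0%N => //=; rewrite ei -iterS em; exact: iter_fnext.
  have ut : uniq (traject (@fnext G) d m).
    exact: uniq_orbit iter_fnext (tiling_face_length hG d).
  by move=> e; rewrite count_edge !count_uniq_mem // oddD !oddb.
elim=> [|s1 t s2 /elem[A [[l Al] Af Ae]] _ _ [A' [[l' Al'] Af' Ae']]|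
    s1 t s2 /elem[A [[l Al] Af Ae]] _ [A' [[l' Al'] Af' Ae']]].
- by exists (fun=> false); split=> //; exists [::].
- exists (fun x => A x (+) A' x); split.
  + exists (l ++ l') => x; rewrite mem_cat; move: (Al x) (Al' x).
    case: (A x); case: (A' x) => //= h h' _; first by rewrite h.
    by rewrite h' ?orbT.
  + by move=> x; rewrite Af Af'.
  + move=> e; rewrite addbACA Ae Ae' !count_cat !oddD.
    by do 3!case: (odd _).
- exists (fun x => A x (+) A' x); split.
  + exists (l ++ l') => x; rewrite mem_cat; move: (Al x) (Al' x).
    case: (A x); case: (A' x) => //= h h' _; first by rewrite h.
    by rewrite h' ?orbT.
  + by move=> x; rewrite Af Af'.
  + move=> e; rewrite addbACA Ae Ae' !count_cat !oddD.
    by do 3!case: (odd _).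
Qed.

(** Close the walk with the edge of [x], which is then crossed exactly once, so the bounded set of
    faces contains just one of its sides. Any other edge where [A] changes is crossed an odd number
    of times, hence at least once. *)
Lemma separation (u : seq bool) (x : D) : run r fl u x = fl x ->
  all (fun y : D => y.1 != x.1) (crossed r fl u x) ->
  exists A : D -> bool, [/\ exists l : seq D, forall y, A y -> y \in l,
    forall y, A (@fnext G y) = A y, A x != A (fl x)
    & forall y, A y != A (fl y) -> y.1 != x.1 -> y.1 \in map fst (crossed r fl u x)].
Proof.
move=> ux nx; pose v := u ++ [:: true].
have vx : run r fl v x = x by rewrite run_cat ux /= /fl flipK.
(* The trivial action on [unit] only serves to see that the crossed darts form a closed walk. *)
have l := run_lift (Y := unit) id (fun y => y) v x tt.
have cv := lift_cycle l (esym vx).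
have [A [finA Af Ae]] := contractible_face_set (tiling_simply_connected hG cv).
have par (y : D) : A y (+) A (fl y) = odd (count (fun z : D => z.1 == y.1) (crossed r fl v x)).
  by rewrite -Ae; case: y => e [] //=; rewrite /fl /flip /= addbC.
have cE : crossed r fl v x = rcons (crossed r fl u x) (fl x).
  by rewrite crossed_cat ux /= cats1.
exists A; split=> //.
  have := par x; rewrite cE -cats1 count_cat /= eqxx.
  have /eqP -> : count (fun z : D => z.1 == x.1) (crossed r fl u x) == 0%N.
    by rewrite -leqn0 leqNgt -has_count -all_predC.
  by case: (A x) (A (fl x)) => [] [].
move=> y; have := par y; rewrite cE -cats1 count_cat /=.
case: (y.1 =P x.1) => [//|ne]; rewrite eq_sym (introF eqP ne) !addn0.
case: (A y) (A (fl y)) => [] [] //= odd_c _ _;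
by have /hasP[z zc /eqP <-] : has (fun z : D => z.1 == y.1) (crossed r fl u x);
  [rewrite has_count; case: (count _ _) odd_c|exact: map_f].
Qed.

End Tiling.

(** * Expectations of functions of finitely many edges *)

Section Expectation.
Context {R : realFieldType} {E : eqType}.
Implicit Types (B : seq E) (w : E -> bool) (F : (E -> bool) -> R) (e f : E) (p q : R).

Lemma upd_comm w e f b c : e <> f -> upd (upd w e b) f c = upd (upd w f c) e b.
Proof.
by move=> ne; apply: funext => g; rewrite /upd; case: (g =P f) => // ->; case: eqP => // /esym.
Qed.

Lemma upd_upd w e b c : upd (upd w e b) e c = upd w e c.
Proof. by apply: funext => g; rewrite /upd; case: eqP. Qed.

(* Polynomial in the parameter: the edges of [B] are random, the other ones are
   in the state prescribed by [w]. *)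
Fixpoint expP B w F : {poly R} :=
  if B is e :: B' then
    'X * expP B' (upd w e true) F + (1 - 'X) * expP B' (upd w e false) F
  else (F w)%:P.

Lemma horner_expP e B w F p : (expP (e :: B) w F).[p] =
  p * (expP B (upd w e true) F).[p] + (1 - p) * (expP B (upd w e false) F).[p].
Proof. by rewrite /= !(hornerD, hornerM, hornerN, hornerX, hornerC). Qed.

Lemma eq_expP B w F F' : F =1 F' -> expP B w F = expP B w F'.
Proof. by move=> eF; elim: B w => [|e B IH] w /=; rewrite ?eF ?IH. Qed.

Lemma expPD B w F F' : expP B w (fun w => F w + F' w) = expP B w F + expP B w F'.
Proof.
elim: B w => [|e B IH] w /=; first by rewrite polyCD.
by rewrite !IH !mulrDr addrACA.
Qed.

Lemma expPZ B w F k : expP B w (fun w => k * F w) = k *: expP B w F.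
Proof.
elim: B w => [|e B IH] w /=; first by rewrite polyCM mul_polyC.
by rewrite !IH scalerDr !scalerAr.
Qed.

Lemma expP_const B w k : expP B w (fun=> k) = k%:P.
Proof.
by elim: B w => //= e B IH w; rewrite !IH -mulrDl addrC subrK mul1r.
Qed.

Lemma expP_front e B w F : e \in B -> uniq B -> expP B w F =
  'X * expP (rem e B) (upd w e true) F + (1 - 'X) * expP (rem e B) (upd w e false) F.
Proof.
elim: B w => //= f B IH w; rewrite inE.
case: (f =P e) => [-> //|/eqP ne]; rewrite eq_sym (negPf ne) /= => eB /andP[_ uB].
have ne' : f <> e by apply/eqP.
rewrite !IH // !(upd_comm _ _ _ ne') !mulrDr addrACA.
by congr (_ + _); congr (_ + _); rewrite mulrCA.
Qed.

(** [C] collects the edges already revealed; with it the induction on [B] can pull each edge to the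
    front of [B']. *)
Lemma expP_local_gen B C B' w w' F : local_on (B ++ C) F -> {in C, w =1 w'} ->
  uniq B -> uniq B' -> {subset B <= B'} -> (forall e, e \in C -> e \notin B') ->
  expP B' w F = expP B w' F.
Proof.
elim: B C B' w w' => [|e B IH] C B' w w' /= loc ww' uB uB' sub dis.
  have -> : F w' = F w by apply: loc => e /ww'.
  elim: B' w {ww' uB' sub} dis => //= e B' IH w dis.
  have FE b : F (upd w e b) = F w.
    apply: loc => f fC; rewrite /upd; case: (f =P e) => // ef.
    by have := dis f fC; rewrite ef mem_head.
  have dis' f : f \in C -> f \notin B' by move/dis; rewrite inE negb_or => /andP[].
  by rewrite !IH // !FE -mulrDl addrC subrK mul1r.
case/andP: uB => eB uB; rewrite (expP_front _ _ (sub e (mem_head _ _))) //.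
have step b : expP (rem e B') (upd w e b) F = expP B (upd w' e b) F.
  apply: (IH (e :: C)) => //.
  - by move=> v v' vv'; apply: loc => f fB; apply: vv'; move: fB;
      rewrite inE !mem_cat inE; case: (f == e); rewrite ?orbT.
  - move=> f; rewrite inE /upd; case: (f =P e) => //= ne; exact: ww'.
  - exact: rem_uniq.
  - move=> f fB; rewrite mem_rem_uniq // inE sub ?inE ?fB ?orbT // andbT.
    by apply: contraNneq eB => <-.
  - move=> f; rewrite mem_rem_uniq // !inE.
    by case: (f =P e) => //= _ /dis.
by rewrite !step.
Qed.

Lemma expP_local B B' w w' F : local_on B F -> uniq B -> uniq B' ->
  {subset B <= B'} -> expP B' w F = expP B w' F.
Proof.
by move=> loc uB uB' sub; apply: (expP_local_gen (C := [::])) => //; rewrite cats0.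
Qed.

Lemma expP_upd B w F f b c : f \notin B ->
  expP B (upd w f b) (fun w => F (upd w f c)) = expP B (upd w f c) F.
Proof.
elim: B w => [|e B IH] w /=; first by rewrite upd_upd.
rewrite inE negb_or => /andP[/eqP ne fB].
by rewrite !(upd_comm _ _ _ ne) !IH.
Qed.

Definition pivot e F : (E -> bool) -> R := fun w => F (upd w e true) - F (upd w e false).

(* Russo's formula. *)
Lemma deriv_expP B w F : uniq B ->
  (expP B w F)^`() = \sum_(e <- B) expP B w (pivot e F).
Proof.
elim: B w => [|f B IH] w; first by rewrite big_nil /= derivC.
case/andP=> fB uB; rewrite big_cons.
have -> : expP (f :: B) w (pivot f F) = expP B (upd w f true) F - expP B (upd w f false) F.
  have pivE b : expP B (upd w f b) (pivot f F) = expP B (upd w f true) F - expP B (upd w f false) F.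
    rewrite /pivot -(expP_upd w F b true fB) -(expP_upd w F b false fB) -scaleN1r -expPZ -expPD.
    by apply: eq_expP => v; rewrite mulN1r.
  by rewrite /= !pivE -mulrDl addrC subrK mul1r.
have -> : \sum_(e <- B) expP (f :: B) w (pivot e F) =
  'X * (expP B (upd w f true) F)^`() + (1 - 'X) * (expP B (upd w f false) F)^`().
  by rewrite !IH // !mulr_sumr -big_split.
rewrite /= derivD !derivM derivB derivX -polyC1 derivC sub0r mul1r mulN1r.
by rewrite [RHS]addrACA.
Qed.

Definition finitary F := exists B, uniq B /\ local_on B F.

Lemma local_on_sub B B' (T : Type) (F : (E -> bool) -> T) :
  {subset B <= B'} -> local_on B F -> local_on B' F.
Proof. by move=> sub loc w w' ww'; apply: loc => e /sub/ww'. Qed.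

Lemma finitary2 F F' : finitary F -> finitary F' ->
  exists B, [/\ uniq B, local_on B F & local_on B F'].
Proof.
move=> [B [_ lF]] [B' [_ lF']]; exists (undup (B ++ B')); split; first exact: undup_uniq.
  by apply: local_on_sub lF => e; rewrite mem_undup mem_cat => ->.
by apply: local_on_sub lF' => e; rewrite mem_undup mem_cat => ->; rewrite orbT.
Qed.

(* Junk value 0 when [F] depends on infinitely many edges. *)
Definition mean F : {poly R} :=
  if pselect (finitary F) is left H then expP (projT1 (cid H)) (fun=> false) F else 0.

Lemma meanE B w F : uniq B -> local_on B F -> mean F = expP B w F.
Proof.
move=> uB lB; rewrite /mean; case: pselect => [H|]; last by case; exists B.
case: (cid H) => /= B' [uB' lB'].
rewrite -(expP_local (fun=> false) _ lB' uB' (undup_uniq (B ++ B'))).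
  by apply: expP_local => //; [exact: undup_uniq|move=> e; rewrite mem_undup mem_cat => ->].
by move=> e; rewrite mem_undup mem_cat => ->; rewrite orbT.
Qed.

Lemma eq_mean F F' : F =1 F' -> mean F = mean F'.
Proof. by move=> /funext ->. Qed.

Lemma finitaryZ k F : finitary F -> finitary (fun w => k * F w).
Proof. by move=> [B [uB lB]]; exists B; split=> // w w' /lB ->. Qed.

Lemma finitaryD F F' : finitary F -> finitary F' -> finitary (fun w => F w + F' w).
Proof.
move=> fF /(finitary2 fF)[B [uB lB lB']]; exists B; split=> // w w' ww'.
by rewrite (lB w w') // (lB' w w').
Qed.

Lemma finitary_const k : finitary (fun=> k).
Proof. by exists [::]. Qed.

Lemma finitary_pivot e F : finitary F -> finitary (pivot e F).
Proof.
move=> [B [uB lB]]; exists B; split=> // w w' ww'; rewrite /pivot.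
by congr (_ - _); apply: lB => f fB; rewrite /upd ww'.
Qed.

Lemma meanD F F' : finitary F -> finitary F' ->
  mean (fun w => F w + F' w) = mean F + mean F'.
Proof.
move=> fF /(finitary2 fF)[B [uB lB lB']].
rewrite (meanE (fun=> false) uB lB) (meanE (fun=> false) uB lB') -expPD.
by apply: meanE => // w w' ww'; rewrite (lB w w') // (lB' w w').
Qed.

Lemma meanZ k F : finitary F -> mean (fun w => k * F w) = k *: mean F.
Proof.
move=> [B [uB lB]]; rewrite (meanE (fun=> false) uB lB) -expPZ.
by apply: meanE => // w w' ww'; rewrite (lB w w').
Qed.

Lemma mean_const k : mean (fun=> k) = k%:P.
Proof. by rewrite (@meanE [::] (fun=> false)). Qed.

Lemma finitary_sum (I : Type) (s : seq I) (F : I -> (E -> bool) -> R) :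
  (forall i, finitary (F i)) -> finitary (fun w => \sum_(i <- s) F i w).
Proof.
move=> fF; elim: s => [|i s IH].
  by rewrite (_ : (fun _ => _) = (fun=> 0)); [exact: finitary_const|apply: funext => w; rewrite big_nil].
rewrite (_ : (fun _ => _) = (fun w => F i w + \sum_(i <- s) F i w)).
  exact: finitaryD.
by apply: funext => w; rewrite big_cons.
Qed.

Lemma mean_sum (I : Type) (s : seq I) (F : I -> (E -> bool) -> R) :
  (forall i, finitary (F i)) ->
  mean (fun w => \sum_(i <- s) F i w) = \sum_(i <- s) mean (F i).
Proof.
move=> fF; elim: s => [|i s IH].
  by rewrite big_nil -polyC0 -mean_const; apply: eq_mean => w; rewrite big_nil.
rewrite big_cons -IH -meanD //; last exact: finitary_sum.
by apply: eq_mean => w; rewrite big_cons.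
Qed.

Lemma deriv_mean B F : uniq B -> local_on B F ->
  (mean F)^`() = \sum_(e <- B) mean (pivot e F).
Proof.
move=> uB lB; rewrite (meanE (fun=> false) uB lB) deriv_expP //.
apply: eq_bigr => e _; apply/esym/meanE => // w w' ww'; rewrite /pivot.
by congr (_ - _); apply: lB => f fB; rewrite /upd ww'.
Qed.

Lemma expP_le B w F F' p : (forall w, F w <= F' w) -> 0 <= p <= 1 ->
  (expP B w F).[p] <= (expP B w F').[p].
Proof.
move=> le /andP[p0 p1]; elim: B w => [|e B IH] w; first by rewrite /= !hornerC.
by rewrite !horner_expP lerD // ler_wpM2l // subr_ge0.
Qed.

Lemma mean_le F F' p : finitary F -> finitary F' -> (forall w, F w <= F' w) ->
  0 <= p <= 1 -> (mean F).[p] <= (mean F').[p].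
Proof.
move=> fF /(finitary2 fF)[B [uB lB lB']] le hp.
by rewrite (meanE (fun=> false) uB lB) (meanE (fun=> false) uB lB') expP_le.
Qed.

Lemma mean_ge0 F p : finitary F -> (forall w, 0 <= F w) -> 0 <= p <= 1 ->
  0 <= (mean F).[p].
Proof.
move=> fF F0 hp; have := mean_le (finitary_const 0) fF F0 hp.
by rewrite mean_const hornerC.
Qed.

(** An induction on edges in place of a monotone coupling: raising the parameter lowers both
    conditional expectations and shifts weight to the open branch, where the expectation is
    smaller. *)
Lemma mean_antitone F p q : finitary F ->
  (forall w w', (forall e, w e -> w' e) -> F w' <= F w) ->
  0 <= p -> p <= q -> q <= 1 -> (mean F).[q] <= (mean F).[p].
Proof.
move=> [B [uB lB]] anti p0 pq q1; rewrite !(meanE (fun=> false) uB lB).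
have p1 : p <= 1 := le_trans pq q1.
have le r B' w w' : 0 <= r -> r <= 1 -> (forall e, w e -> w' e) -> (expP B' w' F).[r] <= (expP B' w F).[r].
  move=> r0 r1; elim: B' w w' => [|e B' IH] w w' ww'; first by rewrite /= !hornerC anti.
  rewrite !horner_expP lerD // ler_wpM2l ?subr_ge0 // IH // => f; rewrite /upd;
  by case: eqP => // _ /ww'.
elim: B (fun=> false) {uB lB} => [|e B IH] w; first by rewrite /= !hornerC.
rewrite !horner_expP; have h1 := IH (upd w e true); have h0 := IH (upd w e false).
have hle : (expP B (upd w e true) F).[p] <= (expP B (upd w e false) F).[p].
  by apply: le => // f; rewrite /upd; case: eqP.
set x1 := (expP B (upd w e true) F).[p] in h1 hle *.
set x0 := (expP B (upd w e false) F).[p] in h0 hle *.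
have : q * (expP B (upd w e true) F).[q] <= q * x1 by rewrite ler_wpM2l // (le_trans p0).
have : (1 - q) * (expP B (upd w e false) F).[q] <= (1 - q) * x0 by rewrite ler_wpM2l // subr_ge0.
have : p * (x0 - x1) <= q * (x0 - x1) by rewrite ler_wpM2r // subr_ge0.
lra.
Qed.

Lemma mean_compl F p : finitary F ->
  (mean F).[1 - p] = (mean (fun w => F (fun e => ~~ w e))).[p].
Proof.
move=> [B [uB lB]].
have key w : (expP B (fun e => ~~ w e) F).[1 - p] = (expP B w (fun w => F (fun e => ~~ w e))).[p].
  elim: B w {uB lB} => [|e B IH] w; first by rewrite /= !hornerC.
  rewrite !horner_expP -!IH subKr addrC.
  by congr (_ * _.[_] + _ * _.[_]); congr expP; apply: funext => f; rewrite /upd; case: eqP.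
rewrite (meanE (fun e => ~~ false) uB lB) (key (fun=> false)); congr _.[_].
by apply/esym/meanE => // w w' ww'; apply: lB => e /ww' ->.
Qed.

Lemma mean_transport (s : E -> E) F : injective s -> finitary F ->
  mean (fun w => F (w \o s)) = mean F.
Proof.
move=> s_inj [B [uB lB]]; rewrite (@meanE (map s B) (fun=> false)) ?map_inj_uniq //; last first.
  by move=> w w' ww'; apply: lB => e eB /=; rewrite ww' // map_f.
rewrite (meanE ((fun=> false) \o s) uB lB); move: (fun=> false) => w.
elim: B w {uB lB} => //= e B IH w; rewrite !IH.
by congr (_ * _ + _ * _); congr expP; apply: funext => f; rewrite /upd /= (inj_eq s_inj).
Qed.

End Expectation.

(** * Mass transport and duality *)

Section Merging.
Context {R : realFieldType} {E : countType}.
Variables (m : nat) (a : E * bool -> E * bool).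
Hypothesis m_gt0 : (0 < m)%N.
Hypothesis am : forall x, iter m a x = x.
Implicit Types (w : E -> bool) (x y d : E * bool).
Variable n : nat.
Hypothesis n_gt0 : (0 < n)%N.

(** The sum over the darts of a cluster below the truncation is 1, so the mean is a number of
    clusters per dart. *)
Definition inv_size d w : R := (csize n (cluster a w d))%:R^-1.

(* Give a cluster of truncated size [t] the mass [1 - t / n]; [merge_loss x] is
   the total mass lost when the edge of [x] is opened. The mass is convex and
   decreasing in the size, which is what makes [merge_loss] antitone. *)
Definition merge_loss x w : R :=
  let w0 := upd w x.1 false in
  if `[< cluster a w0 x (flip x) >] then 0 else
  1 - (csize n (cluster a w0 x) + csize n (cluster a w0 (flip x)) - n)%N%:R / n%:R.

Lemma finitary_inv_size d : finitary (inv_size d).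
Proof.
exists (ball a n d); split; first exact: undup_uniq.
by move=> w w' ww'; rewrite /inv_size (csize_cluster_local ww').
Qed.

Lemma eq_csize_cluster w x y : cluster a w x y ->
  csize n (cluster a w x) = csize n (cluster a w y).
Proof.
move=> xy; apply: eq_csize => z; split; apply: cluster_trans => //.
exact: (cluster_sym m_gt0 am).
Qed.

(** Finitely many edges cannot decide whether [x] and [flip x] are connected when both clusters
    reach size [n]; but then the second branch is [1 - n / n], so both branches are 0. *)
Lemma finitary_merge_loss x : finitary (merge_loss x).
Proof.
exists (undup (ball a n x ++ ball a n (flip x))); split; first exact: undup_uniq.
move=> v v' vv'; rewrite /merge_loss.
set w := upd v _ _; set w' := upd v' _ _.
have ww' e : e \in ball a n x ++ ball a n (flip x) -> w e = w' e.
  by move=> eB; rewrite /w /w' /upd; case: eqP => // _; rewrite vv' // mem_undup.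
have wx : {in ball a n x, w =1 w'} by move=> e eB; rewrite ww' // mem_cat eB.
have wfx : {in ball a n (flip x), w =1 w'} by move=> e eB; rewrite ww' // mem_cat eB orbT.
rewrite (csize_cluster_local wx) (csize_cluster_local wfx).
set A := csize n (cluster a w' x); set B := csize n (cluster a w' (flip x)).
have A_le : (A <= n)%N := csize_le _ _.
have B_le : (B <= n)%N := csize_le _ _.
have AE : csize n (cluster a w x) = A := csize_cluster_local wx.
have BE : csize n (cluster a w (flip x)) = B := csize_cluster_local wfx.
case: (boolP ((A == n) && (B == n))) => [/andP[/eqP An /eqP Bn]|small].
  by rewrite An Bn addnK divff ?subrr ?if_same // pnatr_eq0 -lt0n.
have conn : cluster a w x (flip x) <-> cluster a w' x (flip x).
  have {small}[ltA|ltB] : (A < n)%N \/ (B < n)%N.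
    by move: small; rewrite !ltn_neqAle A_le B_le !andbT; do 2!case: eqP => //; auto.
    split; apply: (@cluster_local _ a n) => //; rewrite ?AE // => e eB.
    by rewrite wx.
  have sym := cluster_sym m_gt0 am.
  have flipflip := flipK x.
  split=> /sym xy; apply: sym; move: xy; apply: (@cluster_local _ a n) => //; rewrite ?BE // => e eB.
  by rewrite wfx.
by congr (if _ then _ else _); apply/asboolP/asboolP => /conn.
Qed.

Lemma merge_loss_ge0 x w : 0 <= merge_loss x w.
Proof.
rewrite /merge_loss; case: ifP => // _.
rewrite subr_ge0 ler_pdivrMr ?ltr0n // mul1r ler_nat leq_subLR.
by rewrite leq_add // csize_le.
Qed.

Lemma merge_loss_antitone x w w' : (forall e, w e -> w' e) ->
  merge_loss x w' <= merge_loss x w.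
Proof.
move=> ww'; have := merge_loss_ge0 x w; rewrite /merge_loss.
have ww0 e : upd w x.1 false e -> upd w' x.1 false e by rewrite /upd; case: eqP => // _ /ww'.
case: (asboolP (cluster a (upd w' x.1 false) x (flip x))) => [_ //|n'].
case: asboolP => [c|n0 _]; first by case: n'; exact: cluster_mono c.
rewrite lerD2l lerN2 ler_pM2r ?invr_gt0 ?ltr0n // ler_nat leq_sub2r //.
by apply: leq_add; apply: csize_mono => y; exact: cluster_mono.
Qed.

(** If [A] is truncated, so is the merged cluster: all terms and the right-hand side vanish, even
    for infinite [A]. Otherwise [A] has exactly [t] darts. *)
Lemma sum_mass (A : E * bool -> Prop) (Y : seq (E * bool)) (M : nat) :
  let t := csize n A in
  (0 < t)%N -> (M <= n)%N -> (t = n -> M = n) -> ((t < n)%N -> (t < M)%N) ->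
  uniq Y -> (forall y, A y -> (M%:R^-1 : R) <> t%:R^-1 -> y \in Y) ->
  \sum_(y <- Y) (if `[< A y >] then (M%:R^-1 - t%:R^-1 : R) else 0) = t%:R / M%:R - 1.
Proof.
move=> t t0 Mn tM tM' uY AY.
have t0' : (t%:R : R) != 0 by rewrite pnatr_eq0 -lt0n.
case: (ltnP t n) => [lt_tn|le_nt]; last first.
  have etn : t = n by apply/eqP; rewrite eqn_leq le_nt csize_le.
  rewrite (tM etn) etn subrr divff -?etn // subrr big1 // => y _.
  by rewrite if_same.
have [s [us ss sA]] := csize_enum lt_tn.
have M0 : (M%:R : R) != 0 by rewrite pnatr_eq0 -lt0n (leq_ltn_trans _ (tM' lt_tn)).
rewrite -big_mkcond big_const_seq iter_addr_0.
have -> : count (fun y => `[< A y >]) Y = t.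
  rewrite /t -ss -size_filter; apply/perm_size/uniq_perm => //; first exact: filter_uniq.
  move=> y; rewrite mem_filter; apply/andP/idP => [[/asboolP/sA //]|ys].
  have Ay : A y by apply/sA.
  split; first exact/asboolP.
  apply: AY => // /invr_inj/eqP; rewrite eqr_nat => /eqP eM.
  by have := tM' lt_tn; rewrite eM ltnn.
by rewrite -[LHS]mulr_natl mulrBr mulfV.
Qed.

(** Opening the edge affects only the clusters of its two ends. With [M] the merged size, their
    darts contribute [tA / M - 1] and [tB / M - 1]. *)
Lemma mass_transport x w (Y : seq (E * bool)) : uniq Y ->
  (forall y, pivot x.1 (inv_size y) w != 0 -> y \in Y) ->
  \sum_(y <- Y) pivot x.1 (inv_size y) w = - merge_loss x w.
Proof.
move=> uY HY; rewrite /merge_loss.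
set w0 := upd w x.1 false; set w1 := upd w x.1 true.
pose A := cluster a w0 x; pose B := cluster a w0 (flip x).
have sym := cluster_sym m_gt0 am.
have merged y : A y \/ B y -> csize n (cluster a w1 y) = csize n (fun z => A z \/ B z).
  by move=> Hy; apply: eq_csize => z; exact: (cluster_upd_merge m_gt0 am).
have other y : ~ A y -> ~ B y -> csize n (cluster a w1 y) = csize n (cluster a w0 y).
  by move=> nA nB; apply: eq_csize => z; exact: (cluster_upd_other m_gt0 am).
case: asboolP => [conn|nconn].
  have AB z : A z \/ B z <-> A z.
    by split=> [[//|Bz]|]; [exact: cluster_trans conn Bz|left].
  rewrite oppr0 big1 // => y _; rewrite /pivot /inv_size -/w0 -/w1.
  case: (pselect (A y)) => [Ay|nA].
    rewrite merged; last by left.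
    by rewrite (eq_csize n AB) (eq_csize_cluster Ay) subrr.
  rewrite other ?subrr // => By; apply: nA; exact: cluster_trans conn By.
have dis z : A z -> ~ B z.
  by move=> Az Bz; apply: nconn; apply: cluster_trans Az _; exact: sym.
set tA := csize n (cluster a w0 x); set tB := csize n (cluster a w0 (flip x)).
pose M := minn n (tA + tB).
have ME : csize n (fun z => A z \/ B z) = M by rewrite csize_disjointU.
have tA0 : (0 < tA)%N by apply: (csize_gt0 (x := x)) => //; exact: cluster_refl.
have tB0 : (0 < tB)%N by apply: (csize_gt0 (x := flip x)) => //; exact: cluster_refl.
have tAn : (tA <= n)%N := csize_le _ _.
have tBn : (tB <= n)%N := csize_le _ _.
have split_pivot y : pivot x.1 (inv_size y) w =
    (if `[< A y >] then M%:R^-1 - tA%:R^-1 else 0) +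
    (if `[< B y >] then M%:R^-1 - tB%:R^-1 else 0).
  rewrite /pivot /inv_size -/w0 -/w1; case: asboolP => [Ay|nA].
    rewrite asboolF; last exact: dis.
    by rewrite addr0 merged ?ME -?(eq_csize_cluster Ay) //; left.
  case: asboolP => [By|nB]; last by rewrite other // subrr addr0.
  by rewrite add0r merged ?ME -?(eq_csize_cluster By) //; right.
rewrite (eq_bigr _ (fun y _ => split_pivot y)) big_split /=.
have sumA : \sum_(y <- Y) (if `[< A y >] then M%:R^-1 - tA%:R^-1 else 0 : R) = tA%:R / M%:R - 1.
  apply: sum_mass => //; rewrite -?/tA /M.
  - exact: geq_minl.
  - by move=> e; have : tA = n := e; lia.
  - by move=> e; have : (tA < n)%N := e; move: tB0; clear; lia.
  - move=> y Ay ne; apply: HY; rewrite split_pivot (asboolT Ay) asboolF; last exact: dis.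
    by rewrite addr0 subr_eq0; apply/eqP.
have sumB : \sum_(y <- Y) (if `[< B y >] then M%:R^-1 - tB%:R^-1 else 0 : R) = tB%:R / M%:R - 1.
  apply: sum_mass => //; rewrite -?/tB /M.
  - exact: geq_minl.
  - by move=> e; have : tB = n := e; lia.
  - by move=> e; have : (tB < n)%N := e; move: tA0; clear; lia.
  - move=> y By ne; apply: HY; rewrite split_pivot (asboolT By) asboolF; last by move=> /dis.
    by rewrite add0r subr_eq0; apply/eqP.
rewrite sumA sumB.
have n0 : (n%:R : R) != 0 by rewrite pnatr_eq0 -lt0n.
rewrite /M; case: (leqP n (tA + tB)) => le_n.
  rewrite natrB // natrD mulrBl (divff n0) mulrDl; lra.
have s0 : (tA + tB)%:R != 0 :> R by rewrite pnatr_eq0 addn_eq0 negb_and -!lt0n tA0.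
have -> : (tA + tB - n = 0)%N by apply/eqP; rewrite subn_eq0 ltnW.
have : tA%:R / (tA + tB)%:R + tB%:R / (tA + tB)%:R = 1 :> R by rewrite -mulrDl -natrD divff.
by rewrite mul0r; lra.
Qed.

End Merging.

(** * Invariance and self-duality of percolation on the tiling *)

Section TilingPercolation.
Context {R : realFieldType} {m : nat} {G : rotation_system} (m_gt1 : (1 < m)%N)
  (hG : regular_plane_tiling m G).
Let D : Type := (edge G * bool)%type.
Let r : D -> D := @Defs.rot G.
Let fl : D -> D := @flip (edge G).
Let m_gt0 : (0 < m)%N := ltnW m_gt1.
Let rm := iter_rot hG.
Let fm := iter_fnext hG.
Variable x0 : D.

(* Russo's formula sums, over the edges, the effect of an edge on the cluster of
   the fixed dart [x0]; by invariance this is the sum, over the darts, of the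
   effect of the edge of [x0] on their clusters. *)
Lemma deriv_mean_inv_size n : (0 < n)%N ->
  (mean (@inv_size R _ r n x0))^`() *+ 2 = - mean (@merge_loss R _ r n x0).
Proof.
move=> n_gt0; pose F d := @inv_size R _ r n d.
have [B [uB lB]] : finitary (F x0) by exact: finitary_inv_size.
rewrite (deriv_mean uB lB) -sumrMnl.
pose B2 : seq D := [seq (e, true) | e <- B] ++ [seq (e, false) | e <- B].
have -> : \sum_(e <- B) mean (pivot e (F x0)) *+ 2 = \sum_(x <- B2) mean (pivot x.1 (F x0)).
  by rewrite big_cat !big_map /= -big_split /=; apply: eq_bigr => e _; rewrite mulr2n.
have uB2 : uniq B2.
  rewrite cat_uniq !map_inj_uniq; try by move=> ? ? [].
  by rewrite uB andbT /=; apply/hasPn => y /mapP[e _ ->]; apply/mapP => -[].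
(* Automorphisms act simply transitively on darts, which identifies darts with group elements;
   [x |-> phi x x0] is then the inversion, whence its injectivity and surjectivity below. *)
pose phi x := projT1 (cid (automorphism m_gt1 hG x x0)).
have phiP x : [/\ phi x x = x0, forall z, phi x (r z) = r (phi x z)
    & forall z, phi x (fl z) = fl (phi x z)] := projT2 (cid (automorphism m_gt1 hG x x0)).
have phi_inj x : injective (phi x) by have [_ pr pf] := phiP x; exact: (automorphism_inj m_gt1 hG).
have pivotE x y w : pivot x0.1 (F (phi x y)) w = pivot x.1 (F y) (w \o edge_map (phi x)).
  have [px pr pf] := phiP x.
  have inj := edge_map_inj (phi_inj x) pf.
  have FE v : F (phi x y) v = F y (v \o edge_map (phi x)).
    by rewrite /F /inv_size (csize_cluster_transport (phi_inj x) pr pf).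
  have ex : edge_map (phi x) x.1 = x0.1 by rewrite -(edge_mapE pf) px.
  rewrite /pivot !FE; congr (F y _ - F y _);
    by apply: funext => e; rewrite /upd /= -ex (inj_eq inj).
have mean_pivot x : mean (pivot x.1 (F x0)) = mean (pivot x0.1 (F (phi x x0))).
  have [px pr pf] := phiP x.
  rewrite (eq_mean (pivotE x x0)) mean_transport //.
    exact: edge_map_inj (phi_inj x) pf.
  by apply: finitary_pivot; exact: finitary_inv_size.
rewrite (eq_bigr _ (fun x _ => mean_pivot x)) -(big_map (fun x => phi x x0) xpredT (fun y => mean (pivot x0.1 (F y)))).
set Y := map _ _.
have uY : uniq Y.
  rewrite map_inj_uniq // => x x' e.
  have [px pr pf] := phiP x; have [px' pr' pf'] := phiP x'.
  have [g [gx0 gr gf]] := automorphism m_gt1 hG x0 x.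
  have gK : forall z, g (phi x z) = z.
    by apply: (equivariant_id hG (x0 := x)) => [z|z|]; rewrite ?pr ?gr ?pf ?gf // px.
  have gK' : forall z, g (phi x' z) = z.
    by apply: (equivariant_id hG (x0 := x0)) => [z|z|]; rewrite ?pr' ?gr ?pf' ?gf // -e gK.
  by rewrite -(gK x) px -px' gK'.
rewrite -mean_sum; last by move=> y; apply: finitary_pivot; exact: finitary_inv_size.
rewrite -scaleN1r -meanZ; last exact: (finitary_merge_loss m_gt0).
apply: eq_mean => w; rewrite mulN1r.
apply: (mass_transport m_gt0) => // y ne.
have [h [hy hr hf]] := automorphism m_gt1 hG y x0.
pose x := h x0; have [px pr pf] := phiP x.
have ey : phi x x0 = y.
  rewrite -hy; apply: (equivariant_id hG (f := phi x \o h) (x0 := x0)) => /= [z|z|//].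
    by rewrite hr pr.
  by rewrite hf pf.
move: ne; rewrite -ey pivotE => ne.
have xB : x.1 \in B.
  apply: contraNT ne => nB; rewrite subr_eq0; apply/eqP; apply: lB => e eB.
  by rewrite /upd; case: eqP => // ee; rewrite -ee eB in nB.
apply: (map_f (fun x => phi x x0)).
rewrite mem_cat; case: (x) xB => e [] eB; apply/orP; [left|right]; exact: map_f.
Qed.

Definition large k d w : R := (k <= csize k (cluster r w d))%N%:R.

Lemma finitary_large k d : finitary (large k d).
Proof.
exists (ball r k d); split; first exact: undup_uniq.
by move=> w w' ww'; rewrite /large (csize_cluster_local ww').
Qed.

Lemma large_mono k d (w w' : edge G -> bool) : (forall e, w e -> w' e) -> large k d w <= large k d w'.
Proof.
move=> ww'; rewrite /large ler_nat.
case: (leqP k (csize k (cluster r w d))) => // le_k; rewrite (leq_trans le_k) // csize_mono // => x.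
exact: cluster_mono.
Qed.

Lemma mean_large_flip k : mean (large k (fl x0)) = mean (large k x0).
Proof.
have [f [fx fr ff]] := automorphism m_gt1 hG x0 (fl x0).
have f_inj := automorphism_inj m_gt1 hG fr ff.
rewrite -[RHS](mean_transport (edge_map_inj f_inj ff)); last exact: finitary_large.
by apply: eq_mean => w; rewrite /large -(csize_cluster_transport f_inj fr ff) fx.
Qed.

Lemma mean_merge_loss_dual n : (0 < n)%N ->
  mean (@merge_loss R _ (@fnext G) n x0) = mean (@merge_loss R _ r n x0).
Proof.
move=> n_gt0; have [f [fx fr ff f_inj]] := self_duality m_gt1 hG x0.
have inj := edge_map_inj f_inj ff.
rewrite -[RHS](mean_transport inj); last exact: (finitary_merge_loss m_gt0).
apply: eq_mean => w; rewrite /merge_loss.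
have -> : upd (w \o edge_map f) x0.1 false = upd w x0.1 false \o edge_map f.
  apply: funext => e; rewrite /upd /= -{2}fx.
  by rewrite (edge_mapE ff) (inj_eq inj).
rewrite -!(csize_cluster_transport f_inj fr ff) ff fx.
have T := cluster_transport fr ff (upd w x0.1 false) x0; rewrite fx in T.
congr (if _ then _ else _); apply/asboolP/asboolP => [/T[y cy ey]|c].
  by rewrite (_ : flip x0 = y) //; apply: f_inj; rewrite ff fx ey.
by apply/T; exists (flip x0) => //; rewrite ff fx.
Qed.

(* If the ends of the edge of [x0] are connected by open edges other than this
   one, the resulting closed walk bounds a finite set of faces which contains
   the whole dual cluster of one of the two faces along the edge. *)
Lemma merge_loss_duality k : exists N : nat, forall n w, (0 < n)%N -> (k.*2 <= n)%N ->
  1 - large k x0 w - large k (fl x0) w - N%:R / n%:R <=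
  @merge_loss R _ r n x0 w + @merge_loss R _ (@fnext G) n x0 (fun e => ~~ w e).
Proof.
pose P u N := run r fl u x0 = fl x0 ->
  all (fun y : D => y.1 != x0.1) (crossed r fl u x0) ->
  exists A : D -> bool, [/\ exists2 l : seq D, (size l <= N)%N & forall y, A y -> y \in l,
    forall y, A (@fnext G y) = A y, A x0 != A (fl x0)
    & forall y, A y != A (fl y) -> y.1 != x0.1 -> y.1 \in map fst (crossed r fl u x0)].
have PN u : exists N, P u N.
  case: (pselect (run r fl u x0 = fl x0 /\ all (fun y : D => y.1 != x0.1) (crossed r fl u x0))).
    move=> [ux nx]; have [A [[l Al] Af Ax Ab]] := separation m_gt1 hG ux nx.
    by exists (size l) => _ _; exists A; split=> //; exists l.
  by move=> no; exists 0%N => ux nx; case: no.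
pose nf u := projT1 (cid (PN u)).
have nfP u : P u (nf u) := projT2 (cid (PN u)).
(* The bound has to be uniform in [w]: a connection inside a small cluster follows one of the words
   of length at most [k]. *)
pose N := \max_(u <- words k) nf u; exists N => n w n_gt0 le_kn.
have n0 : (0 : R) < n%:R by rewrite ltr0n.
have N0 : (0 : R) <= N%:R / n%:R by rewrite divr_ge0.
have L0 : 0 <= @merge_loss R _ r n x0 w by exact: merge_loss_ge0.
have L1 : 0 <= @merge_loss R _ (@fnext G) n x0 (fun e => ~~ w e) by exact: merge_loss_ge0.
have big0 d : 0 <= large k d w by rewrite ler0n.
case: (leqP k (csize k (cluster r w x0))) => [le1|lt1].
  have -> : large k x0 w = 1 by rewrite /large le1.
  by have := big0 (fl x0); lra.
case: (leqP k (csize k (cluster r w (fl x0)))) => [le2|lt2].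
  have -> : large k (fl x0) w = 1 by rewrite /large le2.
  by have := big0 x0; lra.
have -> : large k x0 w = 0 by rewrite /large leqNgt lt1.
have -> : large k (fl x0) w = 0 by rewrite /large leqNgt lt2.
rewrite !subr0; set w0 := upd w x0.1 false.
have w0w e : w0 e -> w e by rewrite /w0 /upd; case: eqP.
have small d : (csize k (cluster r w d) < k)%N -> (csize n (cluster r w0 d) < k)%N.
  move=> lt_k; have [s [_ ss sC]] := csize_enum lt_k.
  apply: leq_ltn_trans lt_k; rewrite -ss; apply: csize_le_size => x /(cluster_mono w0w).
  by move/sC.
have s1 := small _ lt1; have s2 := small _ lt2.
case: (pselect (cluster r w0 x0 (fl x0))) => [conn|nconn]; last first.
  apply: (@le_trans _ _ (@merge_loss R _ r n x0 w)); last by rewrite lerDl.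
  rewrite /merge_loss -/w0 asboolF // (_ : (_ + _ - n = 0)%N); first by rewrite mul0r subr0 lerBlDr lerDl.
  apply/eqP; rewrite subn_eq0 (leq_trans _ le_kn) // -addnn.
  by apply: leq_add; exact: ltnW.
have ltk : (csize k (cluster r w0 x0) < k)%N.
  by apply: leq_ltn_trans lt1; apply: csize_mono => x; exact: cluster_mono.
have [u [su ux au]] := cluster_word ltk conn.
have nx : all (fun y : D => y.1 != x0.1) (crossed r fl u x0).
  by apply: sub_all au => y; rewrite /w0 /upd; case: eqP.
have [A [[l sl Al] Af Ax Ab]] := nfP u ux nx.
have {}sl : (size l <= N)%N.
  apply: leq_trans sl _; apply: (leq_bigmax_seq (F := nf)) => //.
  by rewrite mem_words ltnW.
pose v := upd (fun e => ~~ w e) x0.1 false.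
(* Apart from the edge of [x0], closed in [v], only edges of the walk separate [A] from its
   complement; they are open in [w], hence closed in the dual. *)
have inA z y : A z -> cluster (@fnext G) v z y -> A y.
  move=> Az; elim=> // [t _|t _ At]; first by rewrite Af.
  rewrite /v /upd; case: eqP => // /eqP ne nw.
  apply/negPn/negP => nA.
  have nAt : A t != A (fl t) by rewrite At /fl (negPf nA).
  have /mapP[t' t'c e] := Ab t nAt ne.
  by have := allP au t' t'c; rewrite -e => /w0w; rewrite (negPf nw).
apply: (@le_trans _ _ (@merge_loss R _ (@fnext G) n x0 (fun e => ~~ w e))); last by rewrite lerDr.
have symf := cluster_sym m_gt0 fm.
rewrite /merge_loss -/v asboolF; last first.
  move=> c; case Ax0: (A x0) Ax => /= Afx.
    by move: (inA _ _ Ax0 c) Afx => ->.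
  move: Afx; rewrite eq_sym => /eqP; rewrite /fl; case Af0 : (A (flip x0)) => // _.
  by have := inA _ _ Af0 (symf _ _ _ c); rewrite Ax0.
(* One dual cluster lies in [A] and has at most [N] darts, the other has truncated size at most [n]:
   the excess over [n] is at most [N]. *)
rewrite lerD2l lerN2 ler_pM2r ?invr_gt0 // ler_nat.
case Ax0: (A x0) Ax => /= Afx.
  have : (csize n (cluster (@fnext G) v x0) <= N)%N.
    by apply: leq_trans sl; apply: csize_le_size => y /(inA _ _ Ax0)/Al.
  by have := csize_le n (cluster (@fnext G) v (flip x0)); lia.
have Af0 : A (flip x0) by move: Afx; rewrite /fl; case: (A _).
have : (csize n (cluster (@fnext G) v (flip x0)) <= N)%N.
  by apply: leq_trans sl; apply: csize_le_size => y /(inA _ _ Af0)/Al.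
by have := csize_le n (cluster (@fnext G) v x0); lia.
Qed.

(** Complementing a configuration exchanges [p] and [1 - p], and by self-duality the dual loss has
    the same mean as the primal one. *)
Lemma mean_merge_loss_duality k : exists N : nat, forall n p, (0 < n)%N -> (k.*2 <= n)%N ->
  0 <= p <= 1 ->
  1 - (mean (large k x0)).[p] *+ 2 - N%:R / n%:R <=
  (mean (@merge_loss R _ r n x0)).[p] + (mean (@merge_loss R _ r n x0)).[1 - p].
Proof.
have [N HN] := merge_loss_duality k; exists N => n p n_gt0 le_kn hp.
have fL a' (am' : forall x : D, iter m a' x = x) : finitary (@merge_loss R _ a' n x0).
  exact: (finitary_merge_loss m_gt0 am').
have fLd : finitary (fun w => @merge_loss R _ (@fnext G) n x0 (fun e => ~~ w e)).
  have [B [uB lB]] := fL _ fm; exists B; split=> // w w' ww'.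
  by apply: lB => e /ww' ->.
rewrite -(mean_merge_loss_dual n_gt0) mean_compl; last exact: fL fm.
rewrite (mean_merge_loss_dual n_gt0) -hornerD -meanD //; last exact: fL rm.
have finl d : finitary (fun w => -1 * large k d w) by apply: finitaryZ; exact: finitary_large.
have := mean_le (F := fun w => (1 - N%:R / n%:R) + (-1 * large k x0 w + -1 * large k (fl x0) w)) _
  (finitaryD (fL _ rm) fLd) _ hp.
rewrite !meanD ?mean_const ?meanZ ?mean_large_flip; try exact: finitary_large;
  try exact: finitary_const; try exact: finl; try exact: (finitaryD (finl _) (finl _));
  try exact: fLd; try exact: fL rm.
rewrite !hornerD !hornerC !hornerZ => H.
apply: le_trans (H _ _); first by rewrite mulr2n; lra.
  by apply: finitaryD (finitaryD (finl _) (finl _)); exact: finitary_const.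
by move=> w; apply: le_trans (HN n w n_gt0 le_kn); lra.
Qed.

End TilingPercolation.

(** * Comparison with the regular tree *)

(* Number of ways of discovering exactly [i] further vertices of the m-regular
   tree by exploring [j] pending edges, a new vertex bringing [m.-1] new ones. *)
Fixpoint tree_count (m i : nat) : nat -> nat :=
  if i is i'.+1 then
    fix go j := if j is j'.+1 then (go j' + tree_count m i' (j' + m.-1))%N else 0%N
  else fun=> 1%N.

Arguments tree_count : simpl never.

Lemma tree_count0 m j : tree_count m 0 j = 1%N. Proof. by []. Qed.

Lemma tree_count_stop m i : tree_count m i.+1 0 = 0%N. Proof. by []. Qed.

Lemma tree_countS m i j :
  tree_count m i.+1 j.+1 = (tree_count m i.+1 j + tree_count m i (j + m.-1))%N.
Proof. by []. Qed.

Lemma tree_count_gt0 m i j : (1 < m)%N -> (0 < j)%N -> (0 < tree_count m i j)%N.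
Proof.
move=> m1; elim: i j => // i IH [//|j] _.
by rewrite tree_countS addn_gt0 IH ?orbT // addn_gt0; apply/orP; right; lia.
Qed.

Section Exploration.
Context {R : realFieldType}.
Variables (m : nat) (p : R).
Hypotheses (m_gt1 : (1 < m)%N) (p01 : 0 <= p <= 1).
Let m_gt0 : (0 < m)%N := ltnW m_gt1.

(* For the exploration of a tree cluster with [s] vertices found and [j] edges
   pending, expectation of the inverse of the number of darts, restricted to the
   event that fewer than [N] further vertices are found. *)
Definition tree_bound N j s : R :=
  \sum_(i < N) (tree_count m i j)%:R * p ^+ i * (1 - p) ^+ (j + (m - 2) * i) /
    (m * (s + i))%:R.

Let p0 : 0 <= p. Proof. by case/andP: p01. Qed.
Let q0 : 0 <= 1 - p. Proof. by rewrite subr_ge0; case/andP: p01. Qed.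

Lemma tree_bound_term_ge0 N j s i : 0 <= (tree_count m i j)%:R * p ^+ i * (1 - p) ^+ N /
    (m * (s + i))%:R.
Proof. by rewrite divr_ge0 ?mulr_ge0 ?exprn_ge0 ?ler0n. Qed.

Lemma tree_bound_stop N s : tree_bound N.+1 0 s = (m * s)%:R^-1.
Proof.
rewrite /tree_bound big_ord_recl big1 => [|i _].
  by rewrite /= muln0 addn0 !expr0 !mul1r addr0 addn0.
by rewrite lift0 tree_count_stop !mul0r.
Qed.

(** Examine one pending edge: open, it brings a vertex and [m.-1] pending edges. Each discovery thus
    adds [m - 2] edges to those finally found closed, which gives the exponent of [1 - p]. *)
Lemma tree_boundS N j s : tree_bound N.+1 j.+1 s =
  p * tree_bound N (j + m.-1) s.+1 + (1 - p) * tree_bound N.+1 j s.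
Proof.
rewrite /tree_bound !big_ord_recl mulrDr addrCA; congr (_ + _).
  by rewrite /= !muln0 !addn0 exprS !mulrA; lra.
rewrite !mulr_sumr -big_split; apply: eq_bigr => i _.
rewrite !lift0 tree_countS natrD.
have -> : (j.+1 + (m - 2) * i.+1 = (j + m.-1 + (m - 2) * i))%N.
  by rewrite mulnS; move: m_gt1; set k := ((m - 2) * i)%N; lia.
have -> : (j + m.-1 + (m - 2) * i = (j + (m - 2) * i.+1).+1)%N.
  by rewrite mulnS; move: m_gt1; set k := ((m - 2) * i)%N; lia.
rewrite addSnnS !exprS.
set x := _ ^+ (_ + _); set y := p ^+ i; set u := _^-1.
move: (tree_count m i.+1 j)%:R (tree_count m i _)%:R => c1 c2 /=; lra.
Qed.

Lemma tree_bound_s N j s : (0 < s)%N -> tree_bound N j s.+1 <= tree_bound N.+1 j s.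
Proof.
move=> s0; rewrite [leRHS]/tree_bound big_ord_recr /=.
apply: (@le_trans _ _ (tree_bound N j s)); last by rewrite lerDl tree_bound_term_ge0.
apply: ler_sum => i _; rewrite ler_wpM2l ?mulr_ge0 ?exprn_ge0 ?ler0n //.
rewrite lef_pV2 ?posrE ?ltr0n ?muln_gt0 ?m_gt0 ?addn_gt0 ?s0 //.
by rewrite ler_nat leq_mul2l leq_add2r leqnSn orbT.
Qed.

(** A further pending edge averages [tree_bound] with its value after a discovery, which is smaller
    because the cluster has grown. *)
Lemma tree_bound_anti N j s : (0 < s)%N -> tree_bound N j.+1 s <= tree_bound N j s.
Proof.
elim: N j s => [|N IH] j s s0; first by rewrite /tree_bound !big_ord0.
rewrite tree_boundS.
suff le : tree_bound N (j + m.-1) s.+1 <= tree_bound N.+1 j s.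
  by have := ler_wpM2l p0 le; lra.
apply: le_trans (tree_bound_s _ _ s0); elim: (m.-1) => [|k IHk]; first by rewrite addn0.
by apply: le_trans IHk; rewrite addnS IH.
Qed.

Context {E : countType}.
Variable a : E * bool -> E * bool.
Hypothesis am : forall x, iter m a x = x.
Implicit Types (w : E -> bool) (x y d : E * bool).

Lemma expP_ge (B : seq E) w (F : (E -> bool) -> R) (c : R) :
  (forall v, (forall e, e \notin B -> v e = w e) -> c <= F v) -> c <= (expP B w F).[p].
Proof.
elim: B w => [|e B IH] w H; first by rewrite /= hornerC H.
have step b : c <= (expP B (upd w e b) F).[p].
  apply: IH => v hv; apply: H => f; rewrite inE negb_or => /andP[ne /hv ->].
  by rewrite /upd (negPf ne).
rewrite horner_expP.
by have := ler_wpM2l p0 (step true); have := ler_wpM2l q0 (step false); lra.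
Qed.

(* When an explored dart of [G] leads back to a vertex already found, the tree
   has a supplementary chance of growing, which only decreases [tree_bound].
   Hence no lower bound on the girth of [G] is needed. *)
Lemma exploration n N (L : seq (E * bool)) (B : seq E) w (X : seq (E * bool)) s d :
  (0 < n)%N -> (0 < s)%N -> uniq B -> d \in X ->
  (forall x, x \in X -> a x \in X) -> (size X <= m * s)%N ->
  (forall x, x \in X -> [|| flip x \in X, (x.1 \notin B) && ~~ w x.1
                         | (x \in L) && (x.1 \in B)]) ->
  (forall x, x.1 \notin B -> w x.1 -> x \in X) ->
  tree_bound N (size L) s <= (expP B w (@inv_size R _ a n d)).[p].
Proof.
(* [L] lists the pending darts, [B] the edges still random, [X] the darts found, amounting to at
   most [s] vertices. A dart of [X] leads back into [X], or lies on an edge known to be closed, or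
   is pending. *)
move=> n_gt0; elim: N L B w X s => [|N IHN] L.
  move=> B w X s *; rewrite /tree_bound big_ord0; apply: expP_ge => v _.
  by rewrite invr_ge0 ler0n.
elim: L => [|x L IHL] B w X s s0 uB dX aX sX front opened.
  rewrite tree_bound_stop; apply: expP_ge => v vw.
  have sub y : cluster a v d y -> y \in X.
    elim=> // t _ tX; first exact: aX.
    move=> vt; have := front t tX; rewrite in_nil /= orbF => /orP[//|/andP[nB nw]].
    by move: nw; rewrite -vw // vt.
  rewrite /inv_size lef_pV2 ?posrE ?ltr0n ?muln_gt0 ?m_gt0 ?s0 //.
    by rewrite ler_nat (leq_trans _ sX) // csize_le_size.
  by apply: (csize_gt0 (x := d)) => //; exact: cluster_refl.
have skip : [|| x \notin X, flip x \in X | x.1 \notin B] ->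
    tree_bound N.+1 (size (x :: L)) s <= (expP B w (@inv_size R _ a n d)).[p].
  move=> sk; apply: le_trans (tree_bound_anti _ _ s0) _; apply: (IHL _ _ X) => // y yX.
  have := front y yX; rewrite inE => /or3P[->//|->|/andP[/orP[/eqP ey|->] yB]]; rewrite ?orbT //.
    by move: sk; rewrite -ey yX yB /= orbF => ->.
  by rewrite yB orbT.
case: (boolP (x \in X)) skip => [xX|_ -> //]; case: (boolP (flip x \in X)) => [_ -> //|nfX].
case: (boolP (x.1 \in B)) => [eB _|_ -> //].
rewrite (expP_front _ _ eB uB) !(hornerD, hornerM, hornerN, hornerX, hornerC).
rewrite /= tree_boundS; apply: lerD; rewrite ler_wpM2l //.
  (* Open edge: the vertex of [flip x] is new, and its [m.-1] other darts become pending. *)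
  have -> : (size L + m.-1 = size (L ++ traject a (a (flip x)) m.-1))%N.
    by rewrite size_cat size_traject.
  apply: (IHN _ _ _ (X ++ traject a (flip x) m)) => //.
  - exact: rem_uniq.
  - by rewrite mem_cat dX.
  - move=> y; rewrite !mem_cat => /orP[/aX->//|/trajectP[i lt_i ->]].
    apply/orP; right; rewrite -iterS; apply/trajectP.
    case: (ltnP i.+1 m) => [lt|le]; first by exists i.+1.
    by exists 0%N => //; have -> : i.+1 = m by apply/eqP; rewrite eqn_leq lt_i le.
  - by rewrite size_cat size_traject mulnS addnC leq_add2l.
  - have fX : flip x \in X ++ traject a (flip x) m.
      by rewrite mem_cat; apply/orP; right; apply/trajectP; exists 0%N.
    move=> y yX'; rewrite mem_rem_uniq // inE /upd.
    case: (y.1 =P x.1) => [/same_edge[->|->]|/eqP ne]; first by rewrite fX.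
      by rewrite flipK mem_cat xX.
    rewrite /=; move: yX'; rewrite mem_cat => /orP[yX|yT].
      case/or3P: (front y yX) => [yf|yw|/andP[yL ->]].
      - by rewrite mem_cat yf.
      - by rewrite yw orbT.
      - move: yL; rewrite inE => /orP[/eqP ey|yL]; first by rewrite ey eqxx in ne.
        by rewrite !mem_cat yL !orbT.
    case: (boolP (y.1 \in B)) => yB.
      apply/or3P; apply: Or33; rewrite mem_cat andbT; apply/orP; right.
      case/trajectP: yT => -[|i] lt_i ey; first by rewrite ey eqxx in ne.
      by apply/trajectP; exists i; rewrite ?ey ?iterSr //; move: lt_i; lia.
    case: (boolP (w y.1)) => wy; last by rewrite orbT.
    by rewrite mem_cat (opened (flip y)).
  - move=> y; rewrite mem_rem_uniq // inE /upd mem_cat.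
    case: (y.1 =P x.1) => [/same_edge[->|->] _ _|ne /= yB /(opened y yB)->//].
      by rewrite xX.
    by apply/orP; right; apply/trajectP; exists 0%N.
apply: (IHL _ _ X) => //.
- exact: rem_uniq.
- move=> y yX; rewrite mem_rem_uniq // inE /upd.
  case: (y.1 =P x.1) => [e|/eqP ne]; first by rewrite /= orbT.
  case/or3P: (front y yX) => [->//|/andP[-> ->]|/andP[yL ->]]; rewrite ?orbT //=.
  move: yL; rewrite inE => /orP[/eqP ey|->]; first by rewrite ey eqxx in ne.
  by rewrite !orbT.
- move=> y; rewrite mem_rem_uniq // inE /upd.
  by case: (y.1 =P x.1) => //= ne yB /(opened y yB).
Qed.

Lemma mean_inv_size_ge n N d : (0 < n)%N ->
  tree_bound N m 1 <= (mean (@inv_size R _ a n d)).[p].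
Proof.
move=> n_gt0; have [B [uB lB]] := @finitary_inv_size R _ a n d.
rewrite (meanE (fun=> false) uB lB).
have {1}<- : size (traject a d m) = m by rewrite size_traject.
apply: (@exploration n N _ B _ (traject a d m)) => //.
- by apply/trajectP; exists 0%N.
- move=> y /trajectP[i lt_i ->]; rewrite -iterS; apply/trajectP.
  case: (ltnP i.+1 m) => [lt|le]; first by exists i.+1.
  by exists 0%N => //; have -> : i.+1 = m by apply/eqP; rewrite eqn_leq lt_i le.
- by rewrite size_traject muln1.
- by move=> y yX; rewrite yX; case: (y.1 \in B); rewrite ?orbT /= ?orbT.
Qed.

End Exploration.

(** * Subtrees of the regular tree, counted along the exploration *)

Section Subtrees.
Variable m : nat.
Let T := seq 'I_m.
Implicit Types (u v l : T) (S X : {fset T}) (L : seq T).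

(** Letters are added in front, so the ancestors of a word are its suffixes: this is connectedness
    to the root. *)
Definition suffix_closed S : Prop := forall j u, j :: u \in S -> u \in S.

Lemma suffix_closedP S u v : suffix_closed S -> suffix u v -> v \in S -> u \in S.
Proof.
move=> cl /suffixP[t ->]; elim: t => //= j t IH /cl; exact: IH.
Qed.

Definition subtree_over X L i S : Prop :=
  [/\ suffix_closed S, forall u, u \in S -> @tree_vertex m u,
      {subset X <= S}, #|` S|%fset = (#|` X|%fset + i)%N
    & forall u, u \in S -> u \notin X -> exists2 l, l \in L & suffix l u].

Definition children l : seq T := [seq j :: l | j <- enum 'I_m & Some j != ohead l].

Lemma size_children l : l != [::] -> size (children l) = m.-1.
Proof.
case: l => // j0 l _; rewrite size_map size_filter.
have := count_predC (fun j => Some j == ohead (j0 :: l)) (enum 'I_m).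
have -> : count (fun j => Some j == ohead (j0 :: l)) (enum 'I_m) = 1%N.
  rewrite (eq_count (a2 := pred1 j0)) ?count_uniq_mem ?enum_uniq ?mem_enum //.
by rewrite size_enum_ord => /(congr1 predn) e; exact: e.
Qed.

(** Split on the first pending vertex [l]: either it is outside the subtree and is dropped, or it
    joins [X] and its children become pending. This is the recursion of [tree_count]. *)
Lemma size_subtrees i L X (F : seq {fset T}) : uniq F ->
  (forall S, S \in F -> subtree_over X L i S) ->
  suffix_closed X -> uniq L ->
  (forall l, l \in L -> [/\ l \notin X, l != [::] & behead l \in X]) ->
  (size F <= tree_count m i (size L))%N.
Proof.
elim: i L X F => [|i IHi] L.
  move=> X F uF HF _ _ _; rewrite tree_count0.
  have -> : 1%N = size [:: X] by [].
  apply: uniq_leq_size => // S /HF[_ _ sub card_S _]; rewrite inE eq_sym.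
  by rewrite eqEfcard card_S addn0 leqnn andbT; apply/fsubsetP.
elim: L => [|l L IHL] X F uF HF cX uL HL.
  rewrite tree_count_stop leqn0 size_eq0; case: F uF HF => // S F _ /(_ S (mem_head _ _)).
  case=> _ _ sub card_S H; have eS : S = X.
    apply/fsetP => u; apply/idP/idP => [uS|/sub//].
    by apply/negPn/negP => /(H _ uS)[].
  by move: card_S; rewrite eS; lia.
have [lX l0 tlX] := HL l (mem_head _ _).
have [lL uL'] : l \notin L /\ uniq L by move: uL; rewrite cons_uniq => /andP.
rewrite [size (l :: L)]/= tree_countS -(count_predC (fun S => l \notin S) F) -!size_filter.
apply: leq_add.
  apply: IHL (X) _ (filter_uniq _ uF) _ cX uL' _ => [S|l' l'L]; last first.
    by apply: HL; rewrite inE l'L orbT.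
  rewrite mem_filter => /andP[lS /HF[cS vS sub card_S H]]; split=> // u uS uX.
  have [l' + sl'] := H u uS uX; rewrite inE => /orP[/eqP el|]; last by exists l'.
  by move: lS; rewrite (suffix_closedP cS _ uS) // -el.
rewrite -(size_children l0) -size_cat.
apply: (IHi _ (l |` X)%fset) (filter_uniq _ uF) _ _ _ _.
- move=> S; rewrite mem_filter /= negbK => /andP[lS /HF[cS vS sub card_S H]]; split=> //.
  + by move=> u /fset1UP[->|/sub].
  + by rewrite cardfsU1 lX card_S; lia.
  + move=> u uS; rewrite in_fset1U negb_or => /andP[ul uX].
    have [l' + sl'] := H u uS uX; rewrite inE => /orP[/eqP el|l'L]; last first.
      by exists l' => //; rewrite mem_cat l'L.
    move: sl'; rewrite el => /suffixP[t et]; case/lastP: t et => [|t j] et.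
      by rewrite et eqxx in ul.
    rewrite cat_rcons in et; exists (j :: l); last by rewrite et suffix_suffix.
    rewrite mem_cat; apply/orP; right; apply: map_f; rewrite mem_filter mem_enum andbT.
    have : sorted (fun i j : 'I_m => i != j) (j :: l).
      by move: (vS u uS); rewrite et /tree_vertex; elim: t {et} => //= j' t IH /path_sorted.
    by case: (l) => //= j' l'' /andP[].
- move=> j u; rewrite !in_fset1U => /orP[/eqP el|/cX ->]; last by rewrite orbT.
  by move: tlX; rewrite -el /= => ->; rewrite orbT.
- have uch : uniq (children l).
    rewrite map_inj_uniq; last by move=> ? ? [].
    by rewrite filter_uniq ?enum_uniq.
  rewrite cat_uniq uL' uch andbT.
  apply/hasPn => v /mapP[j _ ->]; apply/negP => vL.
  have /HL[_ _ /=] : j :: l \in l :: L by rewrite inE vL orbT.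
  by rewrite (negPf lX).
- move=> v; rewrite mem_cat => /orP[vL|/mapP[j _ ->]].
    have [vX v0 tv] := HL v (mem_behead (s := l :: L) vL).
    rewrite !in_fset1U negb_or vX tv orbT v0; split=> //; rewrite andbT.
    by apply: contraNneq lL => <-.
  split=> //=; last by rewrite in_fset1U eqxx.
  rewrite in_fset1U negb_or; apply/andP; split.
    by apply/eqP => /(congr1 size) /=; lia.
  by apply: contra lX => /cX.
Qed.

(** Along a walk in [S] from the root, all ancestors of the current vertex stay in [S]: a step
    either adds a visited vertex or returns to an ancestor. *)
Lemma rooted_subtree_over k S : @rooted_subtree m k S ->
  subtree_over [fset [::]]%fset [seq [:: j] | j <- enum 'I_m] k S.
Proof.
case=> rS card_S vS cS.
have walk u (s : seq T) : {subset u :: s <= S} -> path (@tree_adj m) u s ->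
    (forall v, suffix v u -> v \in S) -> forall v, suffix v (last u s) -> v \in S.
  elim: s u => [|u' s IH] u //= sub /andP[/existsP[j adj] ps] su.
  apply: IH ps _ => [v vs|v]; first by apply: sub; rewrite inE vs orbT.
  case/orP: adj => /eqP e; last by move=> svu; apply: su; rewrite e; exact: suffix_trans svu (suffix_cons _ _).
  rewrite e => /suffixP[[|j' t]] et; last by case: et => _ et; apply: su; rewrite et suffix_suffix.
  by rewrite -[v]et -e; apply: sub; rewrite !inE eqxx orbT.
have scl : suffix_closed S.
  move=> j u /cS[s [ps ls sS]]; apply: (walk [::] s) => //.
  - by move=> v; rewrite inE => /orP[/eqP->//|/sS].
  - by move=> v; rewrite suffixs0 => /eqP->.
  - by rewrite ls; exact: (suffix_suffix [:: j]).
split=> //.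
- by move=> u /fset1P->.
- by rewrite cardfs1 card_S add1n.
- move=> u uS; rewrite in_fset1; case/lastP: u uS => // t j uS _.
  exists [:: j]; last by rewrite -cats1 suffix_suffix.
  by apply: map_f; rewrite mem_enum.
Qed.

Lemma subtree_count_le k : (subtree_count m k <= tree_count m k m)%N.
Proof.
(* [fset_set] is empty on an infinite set, where the bound is trivial. *)
rewrite /subtree_count; case: (pselect (finite_set (@rooted_subtree m k))) => [fin|inf]; last first.
  rewrite (_ : fset_set _ = fset0) ?cardfs0 //.
  by rewrite /fset_set; case: pselect.
have e : size [seq [:: j] | j <- enum 'I_m] = m by rewrite size_map size_enum_ord.
rewrite -[X in (_ <= tree_count m k X)%N]e.
apply: (@size_subtrees k _ [fset [::]]%fset).
- exact: fset_uniq.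
- move=> S; rewrite in_fset_set // inE => rS; exact: rooted_subtree_over.
- by move=> j u /fset1P.
- by rewrite map_inj_uniq ?enum_uniq // => ? ? [].
- by move=> l /mapP[j _ ->]; rewrite !in_fset1.
Qed.

Lemma subtree_count0 : subtree_count m 0 = 1%N.
Proof.
rewrite /subtree_count (_ : @rooted_subtree m 0 = [set [fset [::]]%fset]%classic).
  by rewrite fset_set1 cardfs1.
apply/seteqP; split=> [S [rS card_S _ _]|S -> ] /=.
  by apply/eqP; rewrite eq_sym eqEfcard card_S cardfs1 andbT fsub1set.
split; first by rewrite in_fset1.
- by rewrite cardfs1.
- by move=> u /fset1P->.
- by move=> u /fset1P->; exists [::].
Qed.

End Subtrees.

Lemma tree_count1 m j : tree_count m 1 j = j.
Proof. by elim: j => // j IH; rewrite tree_countS IH addn1. Qed.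

(** * Percolation measures *)

Section LocalEvents.
Local Open Scope classical_set_scope.
Context {R : realType} {d : measure_display} {T : measurableType d} {I : eqType}.
Variables (mu : {measure set T -> \bar R}) (Z : T -> I -> bool) (A : set T) (p : R).
Implicit Types (b : I -> bool) (s B : seq I).

Definition weight (c : bool) : R := if c then p else 1 - p.

(** [A] is the region where the states [Z] are sampled: the unit interval for Lebesgue measure, the
    whole space for a percolation measure. *)
Definition cylinder s b : set T := A `&` [set x | forall i, i \in s -> Z x i = b i].

Variable s0 : seq I.
Hypothesis s0_uniq : uniq s0.
Hypothesis cylinder_measurable : forall b, measurable (cylinder s0 b).
Hypothesis cylinder_measure : forall b,
  mu (cylinder s0 b) = (\prod_(i <- s0) weight (b i))%:E.

(** The measure is known on full cylinders over [s0]; smaller [s] are reached by splitting on one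
    edge of [B] at a time, as [expP] does. *)
Lemma cylinder_event (F : (I -> bool) -> bool) s B b : perm_eq (s ++ B) s0 ->
  local_on s0 F ->
  measurable (cylinder s b `&` [set x | F (Z x)]) /\
  mu (cylinder s b `&` [set x | F (Z x)]) =
    ((\prod_(i <- s) weight (b i)) * (expP B b (fun w => (F w)%:R)).[p])%:E.
Proof.
move=> + lF; elim: B s b => [|e B IH] s b perm.
  rewrite cats0 in perm.
  have eC : cylinder s b = cylinder s0 b.
    by apply/seteqP; split=> x [Ax xb]; split=> // i si; apply: xb;
      move: si; rewrite (perm_mem perm).
  have eF x : cylinder s b x -> F (Z x) = F b.
    by rewrite eC => -[_ xb]; exact: lF.
  rewrite /= hornerC; case Fb : (F b).
    have -> : cylinder s b `&` [set x | F (Z x)] = cylinder s0 b.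
      by rewrite -eC; apply/seteqP; split=> [x []//|x Cx]; split=> //=; rewrite eF.
    by rewrite cylinder_measure mulr1 (perm_big _ perm).
  have -> : cylinder s b `&` [set x | F (Z x)] = set0.
    by apply/seteqP; split=> // x [/eF /= ->]; rewrite Fb.
  by rewrite measure0 mulr0.
have uniq_seB : uniq (s ++ e :: B) by rewrite (perm_uniq perm).
have es : e \notin s.
  by move: uniq_seB; rewrite cat_uniq => /and3P[_ /hasPn/(_ e (mem_head _ _))].
have perm' : perm_eq ((e :: s) ++ B) s0.
  by apply: perm_trans perm; rewrite perm_sym perm_catC /= perm_cons perm_catC.
have [mt et] := IH _ (upd b e true) perm'.
have [mf ef] := IH _ (upd b e false) perm'.
have split_cyl : cylinder s b `&` [set x | F (Z x)] =
  (cylinder (e :: s) (upd b e true) `&` [set x | F (Z x)]) `|`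
  (cylinder (e :: s) (upd b e false) `&` [set x | F (Z x)]).
  apply/seteqP; split=> x.
    case=> -[Ax xb] Fx; case Ze: (Z x e); [left|right]; split=> //; split=> // i;
      rewrite inE /upd; case: (i =P e) => [->//|_ /=]; exact: xb.
  case=> -[[Ax xb] Fx]; split=> //; split=> // i si; rewrite xb ?inE ?si ?orbT //;
    by rewrite /upd; case: eqP si => // ->; rewrite (negPf es).
have prodE c : \prod_(i <- e :: s) weight (upd b e c i) = weight c * \prod_(i <- s) weight (b i).
  rewrite big_cons /upd eqxx; congr (_ * _); rewrite big_seq [RHS]big_seq.
  by apply: eq_bigr => i si; case: eqP si => // ->; rewrite (negPf es).
rewrite split_cyl; split; first exact: measurableU.
rewrite measureU //; last first.
  apply/seteqP; split=> // x [[[_ xt] _] [[_ xf] _]].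
  have := xt e (mem_head _ _); rewrite (xf e (mem_head _ _)) /upd eqxx.
  by [].
apply: (eq_trans (f_equal2 (fun u v => (u + v)%E) et ef)).
rewrite !prodE -EFinD; congr EFin; rewrite horner_expP /weight; lra.
Qed.

Lemma local_event (F : (I -> bool) -> bool) : local_on s0 F ->
  measurable (A `&` [set x | F (Z x)]) /\
  mu (A `&` [set x | F (Z x)]) = ((mean (fun w => (F w)%:R)).[p])%:E.
Proof.
move=> lF; have [] := @cylinder_event F [::] s0 (fun=> false) (perm_refl _) lF.
have -> : cylinder [::] (fun=> false) = A by apply/seteqP; split=> [x []|x Ax].
rewrite big_nil mul1r (@meanE _ _ s0 (fun=> false)) // => w w' ww'.
by rewrite (lF w w').
Qed.

End LocalEvents.

Lemma mean_cylinder {R : realType} {I : eqType} (p : R) (s : seq I) (b : I -> bool) :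
  uniq s -> (mean (fun w : I -> bool => (all (fun i => w i == b i) s)%:R)).[p] =
    \prod_(i <- s) weight p (b i).
Proof.
move=> us; rewrite (@meanE _ _ s (fun=> false)) //; last first.
  by move=> w w' ww'; congr (nat_of_bool _)%:R; apply: eq_in_all => i si; rewrite ww'.
suff gen w t : uniq (t ++ s) -> (expP s w (fun w => (all (fun i => w i == b i) (t ++ s))%:R)).[p] =
    (all (fun i => w i == b i) t)%:R * \prod_(i <- s) weight p (b i).
  by rewrite (gen _ [::]) //= mul1r.
elim: s t w {us} => [|e s IH] t w uts; first by rewrite /= cats0 hornerC big_nil mulr1.
rewrite horner_expP.
have uts' : uniq (rcons t e ++ s) by rewrite cat_rcons.
have := IH (rcons t e) _ uts'; rewrite cat_rcons => IH'.
rewrite !IH' big_cons.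
have et : e \notin t.
  by move: uts; rewrite cat_uniq => /and3P[_ /hasPn/(_ e (mem_head _ _))].
have allE c : all (fun i => upd w e c i == b i) (rcons t e) = (c == b e) && all (fun i => w i == b i) t.
  rewrite all_rcons /upd eqxx; congr (_ && _); apply: eq_in_all => i it.
  by case: (i =P e) it => // ->; rewrite (negPf et).
rewrite !allE /weight; case: (b e) => /=; rewrite mul0r mulr0 ?addr0 ?add0r; lra.
Qed.

(** * Independent biased coins read off a uniform point of the unit interval *)

Section Coins.
Local Open Scope classical_set_scope.
Context {R : realType} (p : R) (p01 : 0 <= p <= 1).

(** A half-open interval, coded by its left end and its length, is cut in the proportion [p] to
    [1 - p]. *)
Definition split_itv (c : bool) (I : R * R) : R * R :=
  if c then (I.1, p * I.2) else (I.1 + p * I.2, (1 - p) * I.2).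

Fixpoint coin_itv (x : R) n : R * R :=
  if n is n'.+1 then
    let I := coin_itv x n' in split_itv (x < I.1 + p * I.2) I
  else (0, 1).

Definition coin (x : R) n : bool := x < (coin_itv x n).1 + p * (coin_itv x n).2.

Fixpoint path_itv (b : nat -> bool) n : R * R :=
  if n is n'.+1 then split_itv (b n') (path_itv b n') else (0, 1).

Lemma path_itv_length b n : (path_itv b n).2 = \prod_(i <- iota 0 n) weight p (b i).
Proof.
elim: n => [|n IH]; first by rewrite big_nil.
rewrite -[in iota _ _]addn1 iotaD big_cat /= big_cons big_nil mulr1 -IH add0n.
by rewrite /split_itv /weight; case: (b n); rewrite /= mulrC.
Qed.

Lemma path_itv_ge0 b n : 0 <= (path_itv b n).2.
Proof.
rewrite path_itv_length prodr_ge0 // => i _; rewrite /weight.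
by case: (b i); case/andP: p01; rewrite ?subr_ge0.
Qed.

Lemma coin_path b n x :
  (0 <= x < 1 /\ forall i, i \in iota 0 n -> coin x i = b i) <->
  (path_itv b n).1 <= x < (path_itv b n).1 + (path_itv b n).2.
Proof.
(* The next coin of [x] is read off [coin_itv x n], so its equality with [path_itv b n] is carried
   through the induction. *)
suff [_ //] : (0 <= x < 1 /\ (forall i, i \in iota 0 n -> coin x i = b i) ->
   coin_itv x n = path_itv b n) /\
  ((0 <= x < 1 /\ forall i, i \in iota 0 n -> coin x i = b i) <->
  (path_itv b n).1 <= x < (path_itv b n).1 + (path_itv b n).2).
elim: n => [|n [IH1 IH2]].
  by split=> //=; rewrite add0r; split=> [[]//|xI]; split.
have lastn : n \in iota 0 n.+1 by rewrite mem_iota /= add0n leqnn.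
have restrict : (0 <= x < 1 /\ forall i, i \in iota 0 n.+1 -> coin x i = b i) ->
    (0 <= x < 1 /\ forall i, i \in iota 0 n -> coin x i = b i).
  case=> x01 xb; split=> // i; rewrite mem_iota /= add0n => lt_in.
  by apply: xb; rewrite mem_iota /= add0n ltnW.
split.
  by move=> H; have [_ /(_ n lastn)] := H; rewrite /= /coin IH1; [move=> ->|exact: restrict].
have c0 := path_itv_ge0 b n; case/andP: p01 => p0 p1.
have pc0 : 0 <= p * (path_itv b n).2 by rewrite mulr_ge0.
have qc0 : 0 <= (1 - p) * (path_itv b n).2 by rewrite mulr_ge0 // subr_ge0.
split=> [H|].
  have H' := restrict H; have /IH2 xI := H'; have [_ /(_ n lastn)] := H.
  rewrite /coin IH1 //= /split_itv; case: (b n) => /=.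
    by move=> ->; case/andP: xI => ->.
  move/negbT; rewrite -leNgt => ->; case/andP: xI => _ lt_x /=.
  by move: lt_x; lra.
move=> xI; have /IH2 H : (path_itv b n).1 <= x < (path_itv b n).1 + (path_itv b n).2.
  by move: xI; rewrite /= /split_itv; case: (b n) => /= /andP[] *; apply/andP; split; lra.
have [x01 xb] := H; split=> // i; rewrite mem_iota /= add0n ltnS leq_eqVlt.
case/orP => [/eqP->|lt_in]; last by apply: xb; rewrite mem_iota /= add0n.
rewrite /coin IH1 //; move: xI; rewrite /= /split_itv; case: (b n) => /= /andP[] //.
by move=> le_x _; apply/negbTE; rewrite -leNgt.
Qed.

End Coins.

Section PushProbability.
Local Open Scope classical_set_scope.
Context {d d' : measure_display} {T : measurableType d} {T' : measurableType d'}
  {R : realType} (mu : {measure set T -> \bar R}) (f : T -> T').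
Hypotheses (mf : measurable_fun [set: T] f) (mu1 : mu [set: T] = 1%E).

(** The two proofs are arguments so that the measure and probability instances can be attached to
    this constant. *)
Definition push_prob (_ : measurable_fun [set: T] f) (_ : mu [set: T] = 1%E) :
  set T' -> \bar R := pushforward mu f.

Local Notation P := (push_prob mf mu1).

Let push0 : P set0 = 0%E.
Proof. by rewrite /push_prob /pushforward preimage_set0 measure0. Qed.

Let push_ge0 A : (0 <= P A)%E.
Proof. exact: measure_ge0. Qed.

Let push_sigma_additive : semi_sigma_additive P.
Proof.
move=> F mF tF mUF; rewrite /push_prob /pushforward preimage_bigcup.
apply: measure_semi_sigma_additive.
- by move=> n; rewrite -[X in measurable X]setTI; exact: mf.
- apply/trivIsetP => /= i j _ _ ij; rewrite -preimage_setI.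
  by move/trivIsetP : tF => /(_ _ _ _ _ ij) ->//; rewrite preimage_set0.
- by rewrite -preimage_bigcup -[X in measurable X]setTI; exact: mf.
Qed.

HB.instance Definition _ := isMeasure.Build _ _ _ P push0 push_ge0 push_sigma_additive.

Let push_setT : P [set: T'] = 1%E.
Proof. by rewrite /push_prob /pushforward preimage_setT. Qed.

HB.instance Definition _ := Measure_isProbability.Build _ _ _ P push_setT.

End PushProbability.

Section Existence.
Local Open Scope classical_set_scope.
Context {R : realType} {G : rotation_system} (p : R) (p01 : 0 <= p <= 1).

Definition coin_config (x : measurableTypeR R) : configuration G :=
  fun e => coin p x (choice.pickle e).

Lemma measurable_coin n : measurable_fun [set: measurableTypeR R] (fun x => coin p x n).
Proof.
suff [m1 m2] : measurable_fun [set: measurableTypeR R] (fun x => (coin_itv p x n).1) /\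
    measurable_fun [set: measurableTypeR R] (fun x => (coin_itv p x n).2).
  apply: measurable_fun_ltr => //; apply: measurable_funD => //.
  by apply: measurable_funM => //; exact: measurable_cst.
elim: n => [|n [m1 m2]]; first by split; exact: measurable_cst.
have mc : measurable_fun [set: measurableTypeR R]
    (fun x => x < (coin_itv p x n).1 + p * (coin_itv p x n).2).
  apply: measurable_fun_ltr => //; apply: measurable_funD => //.
  by apply: measurable_funM => //; exact: measurable_cst.
split.
  rewrite (_ : (fun _ => _) = (fun x => if x < (coin_itv p x n).1 + p * (coin_itv p x n).2
      then (coin_itv p x n).1 else (coin_itv p x n).1 + p * (coin_itv p x n).2)).
    apply: measurable_fun_ifT => //; apply: measurable_funD => //.
    by apply: measurable_funM => //; exact: measurable_cst.
  by apply: funext => x /=; rewrite /split_itv; case: ifP.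
rewrite (_ : (fun _ => _) = (fun x => if x < (coin_itv p x n).1 + p * (coin_itv p x n).2
    then p * (coin_itv p x n).2 else (1 - p) * (coin_itv p x n).2)).
  by apply: measurable_fun_ifT => //; apply: measurable_funM => //; exact: measurable_cst.
by apply: funext => x /=; rewrite /split_itv; case: ifP.
Qed.

Lemma measurable_coin_config : measurable_fun [set: measurableTypeR R] coin_config.
Proof.
apply (@measurability _ _ _ _ setT coin_config (@edge_open_events G)); first by [].
move=> _ [_ [e _ <-] <-].
have mt : measurable [set true] by [].
exact: (measurable_coin (choice.pickle e) measurableT mt).
Qed.

Lemma measurable_unit_itv : measurable (`[0, 1[ : set (measurableTypeR R)).
Proof. exact: measurable_itv. Qed.

Let lambda := mrestr (@lebesgue_measure R) measurable_unit_itv.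

Lemma lambda_setT : lambda setT = 1%E.
Proof.
rewrite /lambda /mrestr setTI lebesgue_measure_itv /= lte_fin ltr01.
by rewrite oppr0 adde0.
Qed.

(** Below the threshold no percolation measure sees an infinite cluster; this yields information
    only once such a measure exists. *)
Lemma percolation_exists : exists P : probability (configuration G) R,
  percolation_measure p P.
Proof.
exists (push_prob measurable_coin_config lambda_setT) => s b us.
pose N := \max_(e <- s) (choice.pickle e).+1.
have sN e : e \in s -> choice.pickle e \in iota 0 N.
  move=> es; rewrite mem_iota /= add0n.
  exact: (leq_bigmax_seq (F := fun e => (choice.pickle e).+1)).
pose b' n := if choice.unpickle n is Some e then b e else false.
pose F (w : nat -> bool) := all (fun i => w i == b' i) (map choice.pickle s).
have lF : local_on (iota 0 N) F.
  move=> w w' ww'; apply: eq_in_all => i /mapP[e es ->].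
  by rewrite ww' // sN.
have cyl c : cylinder (T := measurableTypeR R) (coin p) `[0, 1[ (iota 0 N) c =
    `[(path_itv p c N).1, (path_itv p c N).1 + (path_itv p c N).2[.
  apply/seteqP; split=> x /=.
    by rewrite /cylinder /= !in_itv /= => H; exact/(coin_path p01).
  by rewrite in_itv /= => /(coin_path p01)[x01 H]; split=> //=; rewrite in_itv.
have mcyl c : measurable (cylinder (T := measurableTypeR R) (coin p) `[0, 1[ (iota 0 N) c).
  by rewrite cyl; exact: measurable_itv.
have ecyl c : lebesgue_measure (cylinder (T := measurableTypeR R) (coin p) `[0, 1[ (iota 0 N) c)
    = (\prod_(i <- iota 0 N) weight p (c i))%:E.
  rewrite cyl lebesgue_measure_itv /= -path_itv_length lte_fin ltrDl.
  case: ltP => [_|le0]; first by rewrite -EFinD addrAC subrr add0r.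
  by congr EFin; apply/eqP; rewrite eq_le le0 path_itv_ge0.
have [_ eF] := local_event (mu := @lebesgue_measure R) (iota_uniq 0 N) mcyl ecyl lF.
have pinj : injective (@choice.pickle (edge G)) := pcan_inj choice.pickleK.
have us' : uniq (map choice.pickle s) by rewrite map_inj_uniq.
rewrite (mean_cylinder _ _ us') in eF.
rewrite /= /push_prob /pushforward /lambda /mrestr setIC.
rewrite big_map in eF.
have -> : \prod_(e <- s) (if b e then p else 1 - p) = \prod_(j <- s) weight p (b' (choice.pickle j)).
  by apply: eq_bigr => e _; rewrite /b' choice.pickleK.
rewrite -[RHS]eF; congr (lebesgue_measure _); apply/seteqP; split=> x [x01 H]; split=> //=.
  by rewrite /F all_map; apply/allP => e es /=; rewrite /b' choice.pickleK -(H e es).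
move=> e es; move: H => /=; rewrite /F all_map => /allP/(_ e es)/eqP /=.
by rewrite /b' choice.pickleK.
Qed.

End Existence.

(** * Without percolation, large clusters are improbable *)

Section Tail.
Local Open Scope classical_set_scope.
Context {R : realType} {m : nat} {G : rotation_system} (m_gt1 : (1 < m)%N)
  (hG : regular_plane_tiling m G) (p : R) (P : probability (configuration G) R)
  (hP : percolation_measure p P) (e : edge G).
Let m_gt0 : (0 < m)%N := ltnW m_gt1.

Lemma probability_local (B : seq (edge G)) (F : (edge G -> bool) -> bool) :
  uniq B -> local_on B F ->
  measurable ([set w | F w] : set (configuration G)) /\
  P [set w | F w] = ((mean (fun w => (F w)%:R)).[p])%:E.
Proof.
move=> uB lF.
have cylE b : cylinder (fun w : configuration G => w) setT B b =
    [set w : edge G -> bool | forall e, e \in B -> w e = b e].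
  by rewrite /cylinder setTI.
have mopen f c : measurable ([set w : configuration G | w f = c]).
  have mt : measurable ([set w : configuration G | w f]).
    by apply: sub_sigma_algebra; exists f.
  case: c; first exact: mt.
  rewrite (_ : [set w | _] = ~` [set w : configuration G | w f]); first exact: measurableC.
  by apply/seteqP; split=> w /=; [move=> ->|case: (w f)].
have mcyl b : measurable (cylinder (fun w : configuration G => w) setT B b).
  rewrite cylE; elim: (B) => [|f B' IH].
    by rewrite (_ : [set w | _] = setT) //; apply/seteqP; split.
  rewrite (_ : [set w | _] = [set w : configuration G | w f = b f] `&`
    [set w : edge G -> bool | forall e, e \in B' -> w e = b e]).
    exact: measurableI.
  apply/seteqP; split=> w /= H; last by case: H => wf H g; rewrite inE => /orP[/eqP->|/H].
  by split=> [|g gB]; apply: H; rewrite inE ?eqxx ?gB ?orbT.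
have ecyl b : P (cylinder (fun w : configuration G => w) setT B b) =
    (\prod_(i <- B) weight p (b i))%:E.
  by rewrite cylE; exact: hP.
have := local_event (Z := fun w : configuration G => w) uB mcyl ecyl lF.
by rewrite setTI.
Qed.

(** [open_cluster] is empty when [e] is closed, whereas the cluster of darts never is; hence the
    first condition. *)
Definition reaches k (w : edge G -> bool) : bool :=
  w e && (k <= csize k (cluster (@Defs.rot G) w (e, true)))%N.

(** [e] comes first, so that [horner_expP] conditions on its state. *)
Let reach_edges k : seq (edge G) := e :: rem e (ball (@Defs.rot G) k (e, true)).

Let uniq_reach_edges k : uniq (reach_edges k).
Proof. by rewrite /= mem_rem_uniqF ?undup_uniq //= rem_uniq ?undup_uniq. Qed.

Let sub_reach_edges k : {subset ball (@Defs.rot G) k (e, true) <= reach_edges k}.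
Proof.
by move=> f fB; rewrite inE mem_rem_uniq ?undup_uniq // inE fB andbT; case: eqP.
Qed.

Let local_reaches k : local_on (reach_edges k) (reaches k).
Proof.
move=> w w' ww'; rewrite /reaches ww' ?mem_head //; congr (_ && _).
by rewrite (@csize_cluster_local _ _ k (e, true) w w') // => f /sub_reach_edges/ww'.
Qed.

(** An elementary case of positive association: opening [e] can only enlarge the cluster. *)
Lemma mean_large_reaches k : 0 <= p <= 1 ->
  p * (mean (@large R G k (e, true))).[p] <= (mean (fun w => (reaches k w)%:R : R)).[p].
Proof.
move=> p01; have [p0 p1] := andP p01.
rewrite (@meanE _ _ (reach_edges k) (fun=> false)) //; last first.
  move=> w w' ww'; rewrite /large (@csize_cluster_local _ _ k (e, true) w w') //.
  by move=> f /sub_reach_edges/ww'.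
rewrite (@meanE _ _ (reach_edges k) (fun=> false) (fun w => (reaches k w)%:R)) //; last first.
  by move=> w w' ww'; rewrite (local_reaches ww').
rewrite /reach_edges; set B := rem e _; rewrite !horner_expP.
set L := large k _; pose F (w : edge G -> bool) : R := (reaches k w)%:R; rewrite -/F.
have eB : e \notin B by rewrite mem_rem_uniqF ?undup_uniq.
pose w0 : edge G -> bool := fun=> false.
have mono (B' : seq (edge G)) (w w' : edge G -> bool) : (forall f, w f -> w' f) -> (expP B' w L).[p] <= (expP B' w' L).[p].
  elim: B' w w' => [|f B' IH] w w' ww'; first by rewrite /= !hornerC large_mono.
  rewrite !horner_expP; apply: lerD; rewrite ler_wpM2l ?subr_ge0 //; apply: IH => g;
    by rewrite /upd; case: eqP => // _; exact: ww'.
have F1 (B' : seq (edge G)) (w : edge G -> bool) : e \notin B' -> w e -> expP B' w F = expP B' w L.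
  elim: B' w => [|f B' IH] w; first by rewrite /= /F /L /reaches /large => _ ->.
  rewrite inE negb_or => /andP[/eqP ne eB'] we /=.
  by rewrite !IH // /upd; case: eqP.
have F0 : 0 <= (expP B (upd w0 e false) F).[p].
  have -> : 0 = (expP B (upd w0 e false) (fun=> 0 : R)).[p] by rewrite expP_const hornerC.
  by apply: expP_le => // w; rewrite ler0n.
rewrite (F1 B (upd w0 e true)) //; last by rewrite /upd eqxx.
have le : (expP B (upd w0 e false) L).[p] <= (expP B (upd w0 e true) L).[p].
  by apply: mono => f; rewrite /upd; case: eqP.
have q0 : 0 <= 1 - p by rewrite subr_ge0.
have h1 := ler_wpM2l q0 le.
have h2 : 0 <= (1 - p) * (expP B (upd w0 e false) F).[p] by rewrite mulr_ge0.
move: h1 h2; rewrite -/w0.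
set x1 := (expP B (upd w0 e true) L).[p]; set x0 := (expP B (upd w0 e false) L).[p].
move=> h1 h2; apply: (@le_trans _ _ (p * x1)); last by rewrite lerDl.
by rewrite ler_wpM2l //; lra.
Qed.

Lemma open_cluster_infiniteE (w : edge G -> bool) :
  infinite_set (open_cluster w e) <-> forall k, reaches k w.
Proof.
split=> [inf k|H fin].
  have we : w e.
    apply/negPn/negP => nwe; apply: inf.
    rewrite (_ : open_cluster w e = set0) //; apply/seteqP; split=> // f.
    by elim=> // we; rewrite we in nwe.
  rewrite /reaches we /= leqNgt; apply/negP => /csize_enum[s [_ _ sC]].
  apply: inf; apply: (@sub_finite_set _ _ [set` map fst s]); last exact: finite_seq.
  move=> f ef /=; apply/mapP; exists (f, true) => //; apply/sC.
  suff [] : cluster (@Defs.rot G) w (e, true) (f, true) /\ cluster (@Defs.rot G) w (e, true) (f, false) by [].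
  have both g c : w g -> cluster (@Defs.rot G) w (e, true) (g, c) ->
    cluster (@Defs.rot G) w (e, true) (g, true) /\ cluster (@Defs.rot G) w (e, true) (g, false).
    by move=> wg gc; have := cluster_cross gc wg; case: c gc.
  elim: ef => [_|f' g ef' [ft ff] [b [c [k' ek]]] wg].
    by apply: (both e true) => //; exact: cluster_refl.
  apply: (both g c) => //; rewrite -ek.
  have fb : cluster (@Defs.rot G) w (e, true) (f', b) by case: b {ek}.
  by apply: cluster_trans fb _; exact: cluster_iter.
have /finite_seqP[l lE] := fin.
pose s := [seq iter j (@Defs.rot G) x | x <- [seq (f, true) | f <- l] ++ [seq (f, false) | f <- l], j <- iota 0 m].
have sub y : cluster (@Defs.rot G) w (e, true) y -> y \in s.
  move=> cy; have [f [c [j [ef ey]]]] : exists f c j, open_cluster w e f /\ iter j (@Defs.rot G) (f, c) = y.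
    elim: cy => [|t _ [f [c [j [ef <-]]]]|t _ [f [c [j [ef et]]]] wt].
    - exists e, true, 0%N; split=> //; apply: open_cluster_refl.
      by have /andP[] := H 0%N.
    - by exists f, c, j.+1.
    - exists t.1, (~~ t.2), 0%N; split=> //.
      apply: open_cluster_step ef _ wt; exists c, t.2, j; rewrite et.
      by case: (t).
  have fl : f \in l by have : [set` l] f by rewrite -lE.
  rewrite -ey (iter_order_mod (iter_rot hG)); apply: allpairs_f; last first.
    by rewrite mem_iota /= add0n ltn_mod.
  by rewrite mem_cat; case: c {ey}; rewrite map_f ?orbT.
have /andP[_ /leq_csize[_ [t [ut st tC]]]] := H (size s).+1.
have : (size t <= size s)%N by apply: uniq_leq_size => // y /tC/sub.
by rewrite st ltnn.
Qed.

(** The events [reaches k] decrease to the null event of an infinite cluster; continuity from above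
    gives the limit, up to the factor [p]. *)
Lemma mean_large_cvg0 (eps : R) : 0 < p <= 1 -> 0 < eps ->
  ~ (0 < P [set w : edge G -> bool | infinite_set (open_cluster w e)])%E ->
  exists k, (mean (@large R G k (e, true))).[p] < eps.
Proof.
move=> /andP[p0 p1] eps0 no.
pose F k : set (configuration G) := [set w | reaches k w].
have FP k := probability_local (uniq_reach_edges k) (local_reaches (k := k)).
have infE : [set w : edge G -> bool | infinite_set (open_cluster w e)] = \bigcap_k F k.
  apply/seteqP; split=> [w /open_cluster_infiniteE H k _|w H]; first exact: H.
  by apply/open_cluster_infiniteE => k; exact: H.
have mF k : measurable (F k) := (FP k).1.
have cvgF : P \o F @ \oo --> P (\bigcap_k F k).
  apply: nonincreasing_cvg_mu => //.
  - by rewrite (le_lt_trans (probability_le1 P (mF 0%N))) ?ltry.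
  - exact: bigcapT_measurable.
  - move=> k k' le_k; apply/subsetPset => w /andP[we /leq_csize[_ c]].
    rewrite /F /= /reaches we; apply/leq_csize; split=> //.
    exact: contains_uniqW c.
have P0 : P (\bigcap_k F k) = 0%:E.
  by apply/eqP; rewrite eq_le measure_ge0 andbT -infE leNgt; apply/negP.
rewrite P0 in cvgF.
have := cvgr0_norm_lt _ (fine_cvg cvgF) _ (mulr_gt0 p0 eps0).
case=> k _ /(_ k (leqnn k)) /=; rewrite (FP k).2 /= => lt_k; exists k.
have := mean_large_reaches k _; rewrite (ltW p0) p1 => /(_ isT) le_k.
rewrite -(ltr_pM2l p0); apply: le_lt_trans le_k _.
exact: le_lt_trans (ler_norm _) lt_k.
Qed.

End Tail.

(** * Duality combined with concavity *)

Section MainInequality.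
Context {R : realType} {m : nat} {G : rotation_system} (m_gt1 : (1 < m)%N)
  (hG : regular_plane_tiling m G) (x0 : edge G * bool).
Let m_gt0 : (0 < m)%N := ltnW m_gt1.
Let r := @Defs.rot G.
Let rm := iter_rot hG.

Lemma mean_inv_size_closed n : (m <= n)%N ->
  (mean (@inv_size R _ r n x0)).[0] <= m%:R^-1.
Proof.
move=> le_mn; have n_gt0 := leq_trans m_gt0 le_mn.
have [B [uB lB]] := @finitary_inv_size R _ r n x0.
rewrite (meanE (fun=> false) uB lB).
have le_F (w : edge G -> bool) : @inv_size R _ r n x0 w <= m%:R^-1.
  rewrite /inv_size lef_pV2 ?posrE ?ltr0n //; last first.
    by apply: (csize_gt0 (x := x0)) => //; exact: cluster_refl.
  rewrite ler_nat -(minn_idPr le_mn) -{1}(size_traject r x0 m).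
  apply: csize_size; first exact: (uniq_orbit m_gt1 rm (tiling_degree hG x0)).
  by move=> y /trajectP[i _ ->]; exact: cluster_iter.
have := expP_le B (fun=> false) le_F; rewrite expP_const => /(_ 0).
by rewrite lexx ler01 hornerC => ->.
Qed.

(* With [r = - 2 K], where [K] is the mean of [inv_size], one has [r' = h], which
   is nonincreasing, and [h t + h (1 - t) >= 1 - eps] for [t <= p]. Integrating
   the latter bounds [r (1 - p) - r p] above, while concavity bounds it below in
   terms of [r 1 - r p]. *)
Lemma duality_concavity_bound (p eps : R) : 0 < p < 1 / 2 -> 0 < eps ->
  (exists k, (mean (@large R G k x0)).[p] < eps / 4) ->
  p * (1 - p) * (1 - eps) - p * (2 / m%:R) <=
    (1 - 2 * p) * (2 * (m%:R^-1 - @tree_bound R m p m m 1)).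
Proof.
move=> /andP[p0 p2] eps0 [k small].
have [N HN] := mean_merge_loss_duality (R := R) m_gt1 hG x0 k.
(* Besides [2 k <= n] and [m <= n], this ensures [N / n < eps / 4]; with two terms below [eps / 4]
   for large clusters, the total error stays below [eps]. *)
pose n := (k.*2 + m + (Num.truncn (N%:R / (eps / 4) : R)).+1)%N.
have n_gt0 : (0 < n)%N by rewrite /n addnS.
have Nn : N%:R / n%:R < eps / 4.
  rewrite ltr_pdivrMr ?ltr0n // [ltRHS]mulrC -ltr_pdivrMr; last lra.
  by apply: lt_le_trans (truncnS_gt _) _; rewrite ler_nat /n leq_addl.
set K := mean (@inv_size R _ r n x0); set h := mean (@merge_loss R _ r n x0).
have dK : K^`() *+ 2 = - h := deriv_mean_inv_size (R := R) m_gt1 hG x0 n_gt0.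
have fh : finitary (@merge_loss R _ r n x0) by exact: (finitary_merge_loss m_gt0 rm).
have h_anti s t : 0 <= s -> s <= t -> t <= 1 -> h.[t] <= h.[s].
  move=> s0 st t1; apply: mean_antitone => // w w' ww'.
  exact: merge_loss_antitone.
have dKE t : h.[t] = - (2 * K^`().[t]).
  by rewrite -[h]opprK -dK hornerN hornerMn mulr_natl.
have h_dual t : 0 <= t -> t <= p -> 1 - eps <= h.[t] + h.[1 - t].
  move=> t0 tp; have t1 : 0 <= t <= 1 by rewrite t0 /=; lra.
  have le_kn : (k.*2 <= n)%N by rewrite /n; lia.
  have := HN n t n_gt0 le_kn t1; rewrite -/r -/h mulr2n.
  have : (mean (@large R G k x0)).[t] <= (mean (@large R G k x0)).[p].
    have fl : finitary (fun w => -1 * @large R G k x0 w) by apply: finitaryZ; exact: finitary_large.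
    have anti : (mean (fun w => -1 * @large R G k x0 w)).[p] <= (mean (fun w => -1 * @large R G k x0 w)).[t].
      apply: mean_antitone => //; last lra.
      by move=> w w' ww'; rewrite !mulN1r lerN2 large_mono.
    by move: anti; rewrite meanZ ?hornerZ; [lra|exact: finitary_large].
  lra.
have K0 : K.[0] <= m%:R^-1 by apply: mean_inv_size_closed; rewrite /n; lia.
have K1 : 0 <= K.[1].
  apply: mean_ge0; first exact: finitary_inv_size.
    by move=> w; rewrite invr_ge0 ler0n.
  by rewrite ler01 lexx.
have Kp : @tree_bound R m p m m 1 <= K.[p].
  by apply: (mean_inv_size_ge m_gt1 _ rm) => //; apply/andP; split; lra.
have ltp : p < 1 - p by lra.
have lt1 : 1 - p < 1 by lra.
have [c] := poly_mvt K ltp; rewrite in_itv /= => /andP[c1 c2] ec.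
have [d] := poly_mvt K lt1; rewrite in_itv /= => /andP[d1 d2] ed.
(* [F] pairs [t] with [1 - t]: its increment on [[0, p]] gathers those of [K] on [[0, p]] and
   [[1 - p, 1]], where the duality bound applies. *)
pose F : {poly R} := K \Po (1 - 'X) - K.
have [u] := poly_mvt F p0; rewrite in_itv /= => /andP[u1 u2] eu.
have dF : F^`().[u] = - K^`().[1 - u] - K^`().[u].
  rewrite /F derivB deriv_comp derivB derivX -polyC1 derivC sub0r mulrN1.
  by rewrite !hornerE horner_comp !hornerE.
have FE t : F.[t] = K.[1 - t] - K.[t] by rewrite /F !hornerE horner_comp !hornerE.
have hu := h_dual u (ltW u1) (ltW u2).
have hc := h_anti c (1 - p) _ (ltW c2) _.
have hd := h_anti (1 - p) d _ (ltW d1) (ltW d2).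
have {}hc : h.[1 - p] <= h.[c] by apply: hc; lra.
have {}hd : h.[d] <= h.[1 - p] by apply: hd; lra.
rewrite !dKE in hu hc hd; rewrite dF !FE !subr0 in eu.
(* Let A, B, C be twice the decrease of [K] on [[0, p]], [[p, 1 - p]], [[1 - p, 1]]. Concavity
   compares B and C through the slope at [1 - p]; eliminating B and C linearly leaves the bound on
   A. *)
have B_ge : (1 - 2 * p) * (- (2 * K^`().[1 - p])) <= 2 * (K.[p] - K.[1 - p]).
  have : (1 - 2 * p) * (- (2 * K^`().[1 - p])) <= (1 - 2 * p) * (- (2 * K^`().[c])).
    by rewrite ler_wpM2l //; lra.
  have -> : K.[p] - K.[1 - p] = - (K^`().[c] * (1 - p - p)) by rewrite -ec; lra.
  lra.
have C_le : 2 * (K.[1 - p] - K.[1]) <= p * (- (2 * K^`().[1 - p])).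
  have : p * (- (2 * K^`().[d])) <= p * (- (2 * K^`().[1 - p])).
    by rewrite ler_wpM2l //; lra.
  have -> : K.[1 - p] - K.[1] = - (K^`().[d] * (1 - (1 - p))) by rewrite -ed; lra.
  lra.
have AC_ge : (1 - eps) * p <= 2 * (K.[0] - K.[p]) + 2 * (K.[1 - p] - K.[1]).
  have : p * (1 - eps) <= p * (- (2 * K^`().[u]) - (2 * K^`().[1 - u])).
    by rewrite ler_wpM2l //; lra.
  move: eu; lra.
have BC : (1 - 2 * p) * (2 * (K.[1 - p] - K.[1])) <= p * (2 * (K.[p] - K.[1 - p])).
  have h1 : (1 - 2 * p) * (2 * (K.[1 - p] - K.[1])) <= (1 - 2 * p) * (p * (- (2 * K^`().[1 - p]))).
    by rewrite ler_wpM2l //; lra.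
  have h2 : p * ((1 - 2 * p) * (- (2 * K^`().[1 - p]))) <= p * (2 * (K.[p] - K.[1 - p])).
    by rewrite ler_wpM2l //; lra.
  lra.
have T_le : p * (2 * (K.[0] - K.[1])) <= p * (2 / m%:R) by rewrite ler_wpM2l //; lra.
have A_le : (1 - 2 * p) * (2 * (K.[0] - K.[p])) <=
    (1 - 2 * p) * (2 * (m%:R^-1 - @tree_bound R m p m m 1)) by rewrite ler_wpM2l //; lra.
have AC' : (1 - p) * ((1 - eps) * p) <= (1 - p) * (2 * (K.[0] - K.[p]) + 2 * (K.[1 - p] - K.[1])).
  by rewrite ler_wpM2l //; lra.
lra.
Qed.

End MainInequality.

(** * The equation *)

Section Equation.
Context {R : realType} {m : nat} (hm : (5 <= m)%N).
Let m0 : (0 < m%:R :> R). Proof. by rewrite ltr0n; lia. Qed.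
Let m5 : (5 <= m%:R :> R). Proof. by rewrite (ler_nat R 5). Qed.

Let Y : {poly R} := 'X * (1 - 'X) ^+ (m - 2).
Let S : {poly R} :=
  \sum_(k < (m - 2).+1) ((subtree_count m k)%:R / k.+1%:R) *: Y ^+ k.
Let U : {poly R} := 1 - (1 - 'X) ^+ m * S.
(* The equation multiplied by [m p]. *)
Let Q : {poly R} := (1 - 2 *: 'X) * (4 *: U - m%:R *: 'X) - (m%:R - 4) *: 'X.

Lemma horner_S (p : R) : S.[p] = subtree_poly m (m - 2) (p * (1 - p) ^+ (m - 2)).
Proof.
rewrite /S /subtree_poly horner_sum; apply: eq_bigr => k _.
by rewrite hornerZ /Y !hornerE.
Qed.

Lemma horner_U (p : R) : U.[p] = 1 - (1 - p) ^+ m * subtree_poly m (m - 2) (p * (1 - p) ^+ (m - 2)).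
Proof. by rewrite /U hornerD hornerN hornerM horner_S !hornerE. Qed.

Lemma horner_Q (p : R) : Q.[p] = (1 - 2 * p) * (4 * U.[p] - m%:R * p) - (m%:R - 4) * p.
Proof. by rewrite /Q !(hornerD, hornerN, hornerM, hornerZ, hornerX, hornerC). Qed.

Lemma bound_equationE (p : R) : p != 0 -> bound_equation m p <-> Q.[p] = 0.
Proof.
move=> p0; rewrite /bound_equation horner_Q -horner_U.
have mn0 : m%:R != 0 :> R by rewrite gt_eqF.
have mp0 : m%:R * p != 0 by rewrite mulf_neq0.
have e1 : 4 / (m%:R * p) * U.[p] - 1 = (4 * U.[p] - m%:R * p) / (m%:R * p).
  by rewrite mulrBl divff // mulrAC.
have e2 : 1 - 4 / m%:R = ((m%:R - 4) * p) / (m%:R * p) :> R.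
  by rewrite -mulf_div divff // mulr1 mulrBl divff.
rewrite e1 e2 mulrA; split=> [/(mulIf (invr_neq0 mp0)) <-|/eqP]; first by rewrite subrr.
by rewrite subr_eq0 => /eqP->.
Qed.

(** This is the equality case, without error, of [duality_concavity_bound] multiplied by [m], the
    polynomial of the statement standing for [m] times [tree_bound]. *)
Lemma bound_equation_cleared (p : R) : p != 0 -> bound_equation m p ->
  (1 - 2 * p) * (2 * (1 - (1 - p) ^+ m * subtree_poly m (m - 2) (p * (1 - p) ^+ (m - 2)))) =
  m%:R * (p * (1 - p)) - 2 * p.
Proof.
by move=> pn0 /(bound_equationE pn0); rewrite horner_Q -horner_U; lra.
Qed.

Lemma S_at0 : S.[0] = 1.
Proof.
rewrite horner_S mul0r /subtree_poly big_ord_recl big1 => [|k _].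
  by rewrite subtree_count0 !expr0 divr1 mulr1 addr0.
by rewrite lift0 exprS mul0r mulr0.
Qed.

Lemma deriv_S_at0 : S^`().[0] = (subtree_count m 1)%:R / 2.
Proof.
have Y0 : Y.[0] = 0 by rewrite /Y hornerM hornerX mul0r.
have Y'0 : Y^`().[0] = 1.
  rewrite /Y derivM derivX mul1r hornerD hornerM hornerX mul0r addr0.
  by rewrite !hornerE subr0 expr1n.
have -> : S^`() = \sum_(k < (m - 2).+1) ((subtree_count m k)%:R / k.+1%:R) *: (Y ^+ k)^`().
  rewrite /S (big_morph _ (@derivD R) (@deriv0 R)).
  by apply: eq_bigr => k _; rewrite derivZ.
rewrite horner_sum; have -> : ((m - 2).+1 = (m - 3).+2)%N.
  have h2 : (2 < m)%N by exact: leq_trans hm.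
  by rewrite (subnSK h2).
rewrite !big_ord_recl big1 => [|k _].
  rewrite !lift0 /= expr0 expr1 -polyC1 derivC scaler0 horner0 add0r addr0.
  by rewrite hornerZ Y'0 mulr1.
rewrite !lift0 hornerZ deriv_exp /= hornerMn hornerM horner_exp Y0.
by rewrite exprS mul0r mulr0 mul0rn mulr0.
Qed.

Let deriv_Q_gen (V : {poly R}) c d :
  ((1 - 2 *: 'X) * (4 *: V - c *: 'X) - d *: 'X)^`().[0] =
  - (8 * V.[0]) + 4 * V^`().[0] - c - d.
Proof.
rewrite derivB derivM !derivB !derivZ derivX -polyC1 derivC sub0r.
rewrite !(hornerD, hornerN, hornerM, hornerZ, hornerX, hornerC); lra.
Qed.

(** The derivative is [2 m + 4 - 2 a_1] with [a_1 <= m]. As [Q] vanishes at 0, this makes it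
    positive just to the right. *)
Lemma deriv_Q_at0 : 4 <= Q^`().[0].
Proof.
have U0 : U.[0] = 0 by rewrite /U hornerD hornerN hornerM S_at0 !hornerE subr0 expr1n subrr.
have U'0 : U^`().[0] = m%:R - (subtree_count m 1)%:R / 2.
  rewrite /U derivB -polyC1 derivC sub0r derivM hornerN hornerD !hornerM S_at0 deriv_S_at0.
  rewrite horner_exp deriv_exp /= hornerMn hornerM horner_exp derivB derivC derivX sub0r.
  rewrite !(hornerE, subr0, expr1n, mul1r, mulr1) mulNrn /=; lra.
rewrite deriv_Q_gen U0 U'0.
have : (subtree_count m 1)%:R <= m%:R :> R.
  by rewrite ler_nat (leq_trans (subtree_count_le m 1)) ?tree_count1.
lra.
Qed.

(** Dividing [Q] by ['X] removes the root 0: the quotient is positive at 0 and negative at [1 / 2],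
    where the factor [1 - 2 p] vanishes. Its roots in the open unit interval form a sorted list,
    whose head is the solution. *)
Lemma smallest_solution_exists :
  exists2 p : R, smallest_nonzero_solution m p & 0 < p < 1 / 2.
Proof.
have /factor_theorem[g gQ] : root Q 0.
  have U0 : U.[0] = 0 by rewrite /U hornerD hornerN hornerM S_at0 !hornerE subr0 expr1n subrr.
  by rewrite rootE horner_Q U0 !mulr0 !subr0 mulr0 eqxx.
rewrite polyC0 subr0 in gQ.
have QE p : Q.[p] = g.[p] * p by rewrite gQ hornerM hornerX.
have g0 : 0 < g.[0].
  have := deriv_Q_at0; rewrite gQ derivM derivX mulr1 hornerD hornerM hornerX mulr0 add0r.
  by apply: lt_le_trans.
have gh : g.[1 / 2] < 0.
  have := QE (1 / 2); rewrite horner_Q => e.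
  have : 1 - 2 * (1 / 2) = 0 :> R by lra.
  by move=> e0; move: e; rewrite e0 mul0r; have := m5; lra.
have sgn : g.[0] * g.[1 / 2] < 0 by rewrite pmulr_rlt0.
have le_half : 0 <= 1 / 2 :> R by lra.
have [x] := poly_ivtoo le_half sgn; rewrite in_itv => /andP[/= x0 x2] gx.
have gn0 : g != 0 by apply/eqP => e; move: g0; rewrite e horner0 ltxx.
have x_root : x \in roots g 0 1.
  by rewrite in_roots gx in_itv /= x0 gn0 andbT /=; lra.
case e : (roots g 0 1) (sorted_roots 0 1 g) x_root => [//|p s] srt xs.
have min q : q \in roots g 0 1 -> p <= q.
  rewrite e inE => /orP[/eqP->//|qs].
  by apply: ltW; have /order_path_min/allP := srt; apply=> //; exact: lt_trans.
have : p \in roots g 0 1 by rewrite e mem_head.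
rewrite in_roots in_itv /= => /and3P[gp /andP[p0 p1] _].
have px : p <= x by apply: min; rewrite e.
exists p; last by rewrite p0 (le_lt_trans px).
split; first split; rewrite ?(ltW p0) ?(ltW p1) ?gt_eqF //.
  by apply/(bound_equationE (lt0r_neq0 p0)); rewrite QE (rootP gp) mul0r.
move=> q [/andP[q0 q1] qn0 /(bound_equationE qn0)].
rewrite QE => /eqP; rewrite mulf_eq0 (negPf qn0) orbF => gq.
(* [roots] covers the open interval only, so a solution equal to 1 is treated apart. *)
move: q1; rewrite le_eqVlt => /orP[/eqP->|q1]; first exact: ltW.
by apply: min; rewrite in_roots rootE gq in_itv /= lt0r qn0 q0 q1 gn0.
Qed.

(* The excess is the contribution of clusters with exactly [m] vertices. *)
Lemma tree_bound_gt (p : R) : 0 < p < 1 ->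
  (1 - p) ^+ m * subtree_poly m (m - 2) (p * (1 - p) ^+ (m - 2)) < m%:R * tree_bound m p m m 1.
Proof.
move=> /andP[p0 p1]; have q0 : 0 < 1 - p by rewrite subr_gt0.
have h2 : (2 <= m)%N by exact: leq_trans hm.
have -> : m%:R * tree_bound m p m m 1 =
    \sum_(i < (m - 2).+2) ((tree_count m i m)%:R * p ^+ i * (1 - p) ^+ (m + (m - 2) * i) / i.+1%:R).
  have -> : ((m - 2).+2 = m)%N by rewrite -addn2 subnK.
  rewrite /tree_bound mulr_sumr; apply: eq_bigr => i _.
  by rewrite natrM add1n invfM mulrCA [m%:R * _]mulrA divff ?gt_eqF // mul1r.
rewrite big_ord_recr /= mulr_sumr.
set last_term := (X in _ < _ + X).
have last_gt0 : 0 < last_term.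
  rewrite /last_term divr_gt0 ?ltr0n // !mulr_gt0 ?exprn_gt0 // ltr0n.
  by apply: tree_count_gt0; lia.
apply: (@le_lt_trans _ _ (\sum_(i < (m - 2).+1) ((tree_count m i m)%:R * p ^+ i *
    (1 - p) ^+ (m + (m - 2) * i) / i.+1%:R))); last by rewrite ltrDl.
apply: ler_sum => i _; rewrite exprMn -exprM exprD.
have le : (subtree_count m i)%:R <= (tree_count m i m)%:R :> R.
  by rewrite ler_nat; exact: subtree_count_le.
have w0 : 0 <= p ^+ i * ((1 - p) ^+ m * (1 - p) ^+ ((m - 2) * i)) / i.+1%:R.
  by rewrite divr_ge0 // !mulr_ge0 // exprn_ge0 // ltW.
have := ler_wpM2r w0 le.
set a := _ ^+ m; set b := _ ^+ (_ * i); set c := p ^+ i; set d := _^-1.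
by lra.
Qed.

End Equation.

Theorem theorem6p9 (R : realType) (m : nat) (hm : (5 <= m)%N)
    (G : rotation_system) (hG : regular_plane_tiling m G) (e : edge G) :
  exists p : R,
    smallest_nonzero_solution m p /\ critical_probability R e <= p.
Proof.
have [p sol /andP[p0 p2]] := smallest_solution_exists (R := R) hm.
exists p; split=> //; rewrite leNgt; apply/negP => lt_p.
have m_gt1 : (1 < m)%N by lia.
have p1 : p <= 1 by lra.
have p01 : 0 <= p <= 1 by rewrite (ltW p0).
have [P hP] := percolation_exists (G := G) p01.
have no : ~ (0 < P [set w : edge G -> bool | infinite_set (open_cluster w e)]%classic)%E.
  move=> pos; move: lt_p; apply/negP; rewrite -leNgt.
  apply: ge_inf; last by split=> //; exists P.
  by exists 0 => q [/andP[]].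
have mR : 0 < m%:R :> R by rewrite ltr0n ltnW.
have p01' : 0 < p < 1 by rewrite p0; lra.
have gap := tree_bound_gt hm p01'.
have [_ _ eq_p] := sol.1.
set S := subtree_poly _ _ _ in gap; set tb := tree_bound m p m m 1 in gap.
have eqS := bound_equation_cleared hm (lt0r_neq0 p0) eq_p; rewrite -/S in eqS.
(* [gain] is the slack left by clusters of [m] vertices; [eps] is scaled so that the error of the
   bound at [eps / 2] is [gain / 2], which gives the contradiction [gain <= gain / 2]. *)
pose gain := (1 - 2 * p) * (2 * (m%:R * tb - (1 - p) ^+ m * S)).
have gain0 : 0 < gain by rewrite !mulr_gt0 ?subr_gt0 //; lra.
pose eps := gain / (m%:R * (p * (1 - p))).
have q0 : 0 < 1 - p by lra.
have mpq : 0 < m%:R * (p * (1 - p)) by rewrite !mulr_gt0.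
have eps0 : 0 < eps / 2 by rewrite !divr_gt0.
have p01'' : 0 < p <= 1 by rewrite p0.
have [k small] := mean_large_cvg0 m_gt1 hG hP p01'' (divr_gt0 eps0 (ltr0n R 4)) no.
have phalf : 0 < p < 1 / 2 by rewrite p0.
have := duality_concavity_bound m_gt1 hG phalf eps0 (ex_intro _ k small).
rewrite -/tb -(ler_pM2l mR).
have mi : m%:R * m%:R^-1 = 1 :> R by rewrite divff // gt_eqF.
have -> : m%:R * ((1 - 2 * p) * (2 * (m%:R^-1 - tb))) =
    (1 - 2 * p) * (2 * (m%:R * m%:R^-1 - m%:R * tb)) by lra.
have -> : m%:R * (p * (1 - p) * (1 - eps / 2) - p * (2 / m%:R)) =
    m%:R * (p * (1 - p)) - m%:R * (p * (1 - p)) * eps / 2 - 2 * p * (m%:R * m%:R^-1) by lra.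
have -> : m%:R * (p * (1 - p)) * eps = gain by rewrite mulrC divfK // gt_eqF.
rewrite mi => bound; have : gain / 2 < gain by lra.
rewrite {2}/gain; lra.
Qed.
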